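(* Let $\Lambda$ be an Artin algebra that satisfies condition (AC). If $\operatorname{id}_{\Lambda}\Lambda$ is finite, then $\operatorname{id}_{\Lambda^{\circ}}\Lambda$ is finite, and the finitistic dimension of $\Lambda$ is finite on both sides (i.e. both the left and the right finitistic dimension of $\Lambda$ are finite).
   Context: $\Lambda^{\circ}$ is the opposite ring; modules are left modules, so $\operatorname{id}_\Lambda\Lambda$ and $\operatorname{id}_{\Lambda^\circ}\Lambda$ are the injective dimensions of $\Lambda$ as a left, respectively right, module over itself. A left-noetherian ring $A$ satisfies condition (AC) if for every finitely generated left $A$-module $M$ there exists an integer $b_M\geq 0$ such that for every finitely generated left $A$-module $N$ one has: if $\operatorname{Ext}_A^{i}(M,N)=0$ for all $i\gg 0$, then $\operatorname{Ext}_A^{i}(M,N)=0$ for all $i>b_M$. The left (right) finitistic dimension of $\Lambda$ is the supremum of the projective dimensions of those finitely generated left (right) $\Lambda$-modules that have finite projective dimension. *)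

(* Defs.v *)
From HB Require Import structures.
From mathcomp Require Import all_boot all_order all_algebra.
From mathcomp Require Import finmap boolp classical_sets functions cardinality.
From mathcomp Require Import fsbigop.

Set Implicit Arguments.
Unset Strict Implicit.
Unset Printing Implicit Defensive.

Import GRing.Theory.

Local Open Scope ring_scope.

(* Rings are pzRingType's (the zero ring is allowed), and modules are left
   modules [lmodType A].  A right A-module is a left module over the opposite
   ring A^c; A as a left (resp. right) module over itself is A^o (resp.
   A^c^o). *)

Definition exact_at (U V W : nmodType) (f : U -> V) (g : V -> W) : Prop :=
  forall v, g v = 0 <-> exists u, v = f u.

Definition is_zero (V : nmodType) : Prop := forall v : V, v = 0.

Definition surjective (T U : Type) (f : T -> U) : Prop :=
  forall u, exists t, f t = u.

Section Modules.
Variable A : pzRingType.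

Definition finitely_generated (M : lmodType A) : Prop :=
  exists n (g : 'I_n -> M), forall x, exists c : 'I_n -> A,
    x = \sum_(i < n) c i *: g i.

Definition projective (P : lmodType A) : Prop :=
  forall (M N : lmodType A) (p : {linear M -> N}) (f : {linear P -> N}),
    surjective p -> exists h : {linear P -> M}, forall x, p (h x) = f x.

Definition injective_module (I : lmodType A) : Prop :=
  forall (M N : lmodType A) (j : {linear M -> N}) (f : {linear M -> I}),
    injective j -> exists h : {linear N -> I}, forall x, h (j x) = f x.

(*  ... -> P 2 -> P 1 -> P 0 -> M -> 0  *)
Record projective_resolution (M : lmodType A) := ProjectiveResolution {
  pres :> nat -> lmodType A;
  pres_d : forall i, {linear pres i.+1 -> pres i};
  pres_aug : {linear pres 0 -> M};
  pres_projective : forall i, projective (pres i);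
  pres_aug_surj : surjective pres_aug;
  pres_exact0 : exact_at (pres_d 0) pres_aug;
  pres_exactS : forall i, exact_at (pres_d i.+1) (pres_d i) }.

(*  0 -> M -> I 0 -> I 1 -> I 2 -> ...  *)
Record injective_resolution (M : lmodType A) := InjectiveResolution {
  ires :> nat -> lmodType A;
  ires_d : forall i, {linear ires i -> ires i.+1};
  ires_aug : {linear M -> ires 0};
  ires_injective : forall i, injective_module (ires i);
  ires_aug_inj : injective ires_aug;
  ires_exact0 : exact_at ires_aug (ires_d 0);
  ires_exactS : forall i, exact_at (ires_d i) (ires_d i.+1) }.

Definition proj_dim_le (M : lmodType A) (n : nat) : Prop :=
  exists P : projective_resolution M, forall i, (n < i)%N -> is_zero (P i).

Definition inj_dim_le (M : lmodType A) (n : nat) : Prop :=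
  exists I : injective_resolution M, forall i, (n < i)%N -> is_zero (I i).

Definition finite_proj_dim (M : lmodType A) : Prop :=
  exists n, proj_dim_le M n.

Definition finite_inj_dim (M : lmodType A) : Prop :=
  exists n, inj_dim_le M n.

End Modules.

(* n is an upper bound of the projective dimensions whose supremum is the left
   finitistic dimension of A. *)
Definition findim_le (A : pzRingType) (n : nat) : Prop :=
  forall M : lmodType A,
    finitely_generated M -> finite_proj_dim M -> proj_dim_le M n.

Definition finite_findim (A : pzRingType) : Prop := exists n, findim_le A n.

Section KernelZmod.
Variables (V W : zmodType) (g : {additive V -> W}).

Definition zker_pred : {pred V} := [pred v | g v == 0].

Fact zker_zmod_closed : zmod_closed zker_pred.
Proof.
split=> [|x y]; rewrite !inE ?raddf0// => /eqP gx /eqP gy.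
by rewrite raddfB gx gy subrr.
Qed.

HB.instance Definition _ := GRing.isZmodClosed.Build V zker_pred zker_zmod_closed.

Record zker : Type := ZKer { zker_val : V; _ : zker_val \in zker_pred }.

HB.instance Definition _ := [isSub for zker_val].
HB.instance Definition _ := [Choice of zker by <:].
HB.instance Definition _ := [SubChoice_isSubZmodule of zker by <:].

End KernelZmod.

Section Homology.
Variables (U V W : zmodType) (f : {additive U -> V}) (g : {additive V -> W}).

Definition boundary_pred : {pred zker g} := fun z => `[< exists u, val z = f u >].

Fact boundary_zmod_closed : zmod_closed boundary_pred.
Proof.
split=> [|x y]; rewrite !unfold_in.
  by apply/asboolP; exists 0; rewrite !raddf0.
move=> /asboolP[u xu] /asboolP[v yv]; apply/asboolP; exists (u - v).
by rewrite !raddfB/= xu yv.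
Qed.

HB.instance Definition _ :=
  GRing.isZmodClosed.Build (zker g) boundary_pred boundary_zmod_closed.

(* ker g / (im f `&` ker g); the composite g \o f is not required to vanish. *)
Definition homology : zmodType := Quotient.quot boundary_pred.

End Homology.

Section KernelLmod.
Variables (A : pzRingType) (V W : lmodType A) (g : {linear V -> W}).

Definition modker_pred : {pred V} := [pred v | g v == 0].

Fact modker_submod_closed : submod_closed modker_pred.
Proof.
split=> [|a x y]; rewrite !inE ?linear0// => /eqP gx /eqP gy.
by rewrite linearP gx gy scaler0 addr0.
Qed.

HB.instance Definition _ :=
  GRing.isSubmodClosed.Build A V modker_pred modker_submod_closed.

Record modker_of : Type := ModKer { modker_val : V; _ : modker_val \in modker_pred }.

HB.instance Definition _ := [isSub for modker_val].
HB.instance Definition _ := [Choice of modker_of by <:].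
HB.instance Definition _ := [SubChoice_isSubLmodule of modker_of by <:].

Definition modker : lmodType A := modker_of.

End KernelLmod.

Definition Hom (A : pzRingType) (M N : lmodType A) : Type := {linear M -> N}.

Section HomZmod.
Variables (A : pzRingType) (M N : lmodType A).

HB.instance Definition _ := gen_eqMixin (Hom M N).
HB.instance Definition _ := gen_choiceMixin (Hom M N).

Lemma HomP (f g : Hom M N) : f =1 g -> f = g.
Proof.
case: f g => [f [[af] [sf]]] [g [[ag] [sg]]] /= /funext fg.
case: _ / fg in ag sg *.
by rewrite (Prop_irrelevance af ag) (Prop_irrelevance sf sg).
Qed.

Let hom0 : Hom M N := \0 : {linear M -> N}.
Let homN (f : Hom M N) : Hom M N := \- f : {linear M -> N}.
Let homD (f g : Hom M N) : Hom M N := f \+ g : {linear M -> N}.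

Fact homDA : associative homD.
Proof. by move=> f g h; apply: HomP => x /=; rewrite addrA. Qed.
Fact homDC : commutative homD.
Proof. by move=> f g; apply: HomP => x /=; rewrite addrC. Qed.
Fact hom0D : left_id hom0 homD.
Proof. by move=> f; apply: HomP => x /=; rewrite add0r. Qed.
Fact homND : left_inverse hom0 homN homD.
Proof. by move=> f; apply: HomP => x /=; rewrite addNr. Qed.

HB.instance Definition _ :=
  GRing.isZmodule.Build (Hom M N) homDA homDC hom0D homND.

End HomZmod.

Section Pullback.
Variables (A : pzRingType) (M' M N : lmodType A) (d : {linear M' -> M}).

Definition pullback (f : Hom M N) : Hom M' N := f \o d : {linear M' -> N}.

Fact pullback_zmod_morphism : zmod_morphism pullback.
Proof. by move=> f g; apply: HomP. Qed.

HB.instance Definition _ :=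
  GRing.isZmodMorphism.Build (Hom M N) (Hom M' N) pullback
    pullback_zmod_morphism.

End Pullback.

(* H^i(Hom_A(P, N)) *)
Definition ext_of (A : pzRingType) (M : lmodType A)
    (P : projective_resolution M) (N : lmodType A) (i : nat) : zmodType :=
  match i with
  | 0 => homology (\0 : {additive Hom (P 0) N -> Hom (P 0) N})
                  (@pullback A _ _ N (pres_d P 0))
  | j.+1 => homology (@pullback A _ _ N (pres_d P j))
                     (@pullback A _ _ N (pres_d P j.+1))
  end.

(* The free module on T: functions T -> A of finite support. *)
Section FreeModule.
Variables (A : pzRingType) (T : choiceType).

Definition finsupp_pred : {pred T -> A^o} :=
  fun f => `[< finite_set (f @^-1` [set~ 0])%classic >].

Lemma finsuppP (f : T -> A^o) :
  reflect (exists X : {fset T}, forall t, t \notin X -> f t = 0)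
          (f \in finsupp_pred).
Proof.
apply: (iffP (asboolP _)) => [/finite_fsetP[X eX]|[X fX]].
  exists X => t tX; apply: contrapT => ft0.
  by move: tX => /negP; apply; have : [set` X]%classic t by rewrite -eX.
apply: (finite_subfset X) => t /= ft.
by apply: contrapT => /negP /fX.
Qed.

Fact finsupp_submod_closed : submod_closed finsupp_pred.
Proof.
split=> [|a f g /finsuppP[X fX] /finsuppP[Y gY]]; apply/finsuppP.
  by exists fset0.
exists (X `|` Y)%fset => t; rewrite in_fsetU negb_or => /andP[/fX ft /gY gt].
by rewrite [LHS](_ : _ = a *: f t + g t)// ft gt scaler0 addr0.
Qed.

HB.instance Definition _ :=
  GRing.isSubmodClosed.Build A (T -> A^o) finsupp_pred finsupp_submod_closed.

Record freemod_of : Type :=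
  FreeMod { freemod_val : T -> A^o; _ : freemod_val \in finsupp_pred }.

HB.instance Definition _ := [isSub for freemod_val].
HB.instance Definition _ := [Choice of freemod_of by <:].
HB.instance Definition _ := [SubChoice_isSubLmodule of freemod_of by <:].

Definition freemod : lmodType A := freemod_of.

Definition freemod_coef (f : freemod) (t : T) : A := freemod_val f t.

Lemma freemod_supp (f : freemod) :
  exists X : {fset T}, forall t, t \notin X -> freemod_coef f t = 0.
Proof. exact/finsuppP/(valP f). Qed.

Variables (M : lmodType A) (u : T -> M).

Definition freemod_lift (f : freemod) : M :=
  \sum_(t \in [set: T]%classic) freemod_coef f t *: u t.

Lemma freemod_liftE (f : freemod) (X : {fset T}) :
  (forall t, t \notin X -> freemod_coef f t = 0) ->
  freemod_lift f = \sum_(t <- X) freemod_coef f t *: u t.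
Proof. by move=> fX; apply: fsbigTE => t /fX ->; rewrite scale0r. Qed.

Fact freemod_lift_linear : linear freemod_lift.
Proof.
move=> a f g; have [X fX] := freemod_supp f; have [Y gY] := freemod_supp g.
have fXY t : t \notin (X `|` Y)%fset -> freemod_coef f t = 0.
  by rewrite in_fsetU negb_or => /andP[/fX].
have gXY t : t \notin (X `|` Y)%fset -> freemod_coef g t = 0.
  by rewrite in_fsetU negb_or => /andP[_ /gY].
set h := a *: f + g; have E t : freemod_coef h t = a * freemod_coef f t + freemod_coef g t by [].
rewrite (freemod_liftE fXY) (freemod_liftE gXY).
rewrite (@freemod_liftE h (X `|` Y)%fset); last first.
  by move=> t tXY; rewrite E fXY// gXY// mulr0 addr0.
rewrite scaler_sumr -big_split; apply: eq_bigr => t _.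
by rewrite E scalerDl scalerA.
Qed.

HB.instance Definition _ :=
  GRing.isLinear.Build A freemod M *:%R freemod_lift freemod_lift_linear.

End FreeModule.

Section FreeModuleTheory.
Variables (A : pzRingType) (T : choiceType).

Fact freemod_delta_subproof (t : T) :
  (fun s => (s == t)%:R : A^o) \in @finsupp_pred A T.
Proof.
by apply/finsuppP; exists [fset t]%fset => s; rewrite in_fset1 => /negPf ->.
Qed.

Definition freemod_delta (t : T) : freemod A T :=
  FreeMod (freemod_delta_subproof t).

Lemma freemod_coefZ a (f : freemod A T) t : freemod_coef (a *: f) t = a * freemod_coef f t.
Proof. by []. Qed.

Lemma freemod_coef_sum (I : Type) (r : seq I) (F : I -> freemod A T) t :
  freemod_coef (\sum_(i <- r) F i) t = \sum_(i <- r) freemod_coef (F i) t.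
Proof. exact: (big_morph (fun f : freemod A T => freemod_coef f t)). Qed.

Lemma freemod_coef_delta s t : freemod_coef (freemod_delta t) s = (s == t)%:R.
Proof. by []. Qed.

Lemma freemod_lift_delta (M : lmodType A) (u : T -> M) t :
  freemod_lift u (freemod_delta t) = u t.
Proof.
rewrite (@freemod_liftE _ _ _ _ _ [fset t]%fset) => [|s].
  by rewrite big_seq_fset1/= eqxx scale1r.
by rewrite in_fset1 /= => /negPf ->.
Qed.

Lemma freemod_eta (f : freemod A T) : f = freemod_lift freemod_delta f.
Proof.
have [X fX] := freemod_supp f; rewrite (freemod_liftE _ fX).
apply/val_inj/funext => s; rewrite -[LHS]/(freemod_coef f s) -[RHS]/(freemod_coef _ s) freemod_coef_sum.
under eq_bigr do rewrite freemod_coefZ freemod_coef_delta.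
have [sX|sX] := boolP (s \in X); last first.
  rewrite fX// big1_seq// => t /andP[_ tX].
  by case: eqP sX tX => [->/negPf ->|]; rewrite ?mulr0.
rewrite (big_fsetD1 s)//= eqxx mulr1 big1_seq ?addr0// => t /andP[_].
by rewrite in_fsetD1 eq_sym => /andP[/negPf -> _]; rewrite mulr0.
Qed.

Lemma freemod_projective : projective (freemod A T).
Proof.
move=> M N p f p_surj.
have [u pu] : exists u : T -> M, forall t, p (u t) = f (freemod_delta t).
  exists (fun t => sval (cid (p_surj (f (freemod_delta t))))) => t.
  by case: cid.
exists (freemod_lift u) => x; have [X xX] := freemod_supp x.
rewrite /= (freemod_liftE _ xX) [in RHS](freemod_eta x) (freemod_liftE _ xX).
by rewrite !linear_sum; apply: eq_bigr => t _; rewrite !linearZ /= pu.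
Qed.

End FreeModuleTheory.

(* The canonical free resolution of M: each syzygy is covered by the free
   module on its underlying set. *)
Section FreeResolution.
Variables (A : pzRingType) (M : lmodType A).

Definition freecov (N : lmodType A) : {linear freemod A N -> N} :=
  freemod_lift idfun.

Lemma freecov_surj N : surjective (freecov N).
Proof. by move=> x; exists (freemod_delta A x); exact: freemod_lift_delta. Qed.

Fixpoint syz (i : nat) : lmodType A :=
  match i with 0 => M | j.+1 => modker (freecov (syz j)) end.

Definition free_d (i : nat) : {linear freemod A (syz i.+1) -> freemod A (syz i)} :=
  (val : {linear modker (freecov (syz i)) -> freemod A (syz i)})
    \o freecov (syz i.+1).

Lemma free_d_exact i : exact_at (free_d i) (freecov (syz i)).
Proof.
move=> v; split=> [v0|[u ->]].
  have vK : v \in modker_pred (freecov (syz i)) by apply/eqP.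
  have [u uE] := @freecov_surj (syz i.+1) (ModKer vK).
  by exists u; rewrite /free_d /= uE.
by apply/eqP; exact: (valP (freecov (syz i.+1) u)).
Qed.

Lemma free_d_exactS i : exact_at (free_d i.+1) (free_d i).
Proof.
move=> v; rewrite -free_d_exact /free_d /=; split=> [v0|->//].
exact/val_inj.
Qed.

Definition free_resolution : projective_resolution M :=
  @ProjectiveResolution A M (fun i => freemod A (syz i)) free_d (freecov M)
    (fun i => @freemod_projective A (syz i)) (@freecov_surj M)
    (@free_d_exact 0) (@free_d_exactS).

End FreeResolution.

(* Ext is computed from the canonical free resolution, so that it is a function
   of M and N. *)
Definition Ext (A : pzRingType) (i : nat) (M N : lmodType A) : zmodType :=
  ext_of (free_resolution M) N i.

(* Auslander's condition on vanishing of cohomology *)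
Definition satisfies_AC (A : pzRingType) : Prop :=
  forall M : lmodType A, finitely_generated M -> exists b : nat,
    forall N : lmodType A, finitely_generated N ->
      (exists n : nat, forall i, (n < i)%N -> is_zero (Ext i M N)) ->
      forall i, (b < i)%N -> is_zero (Ext i M N).

(* Descending chain condition on ideals; an ideal of k is a submodule of k^o. *)
Definition artinian (k : comPzRingType) : Prop :=
  forall I : nat -> {pred k^o},
    (forall n, submod_closed (I n)) ->
    (forall n, {subset I n.+1 <= I n}) ->
    exists n, forall m, (n <= m)%N -> I m =i I n.

(* A is finitely generated as a module over an artinian commutative ring k
   mapping to its centre. *)
Definition artin_algebra (A : pzRingType) : Prop :=
  exists (k : comPzRingType) (phi : {rmorphism k -> A}),
    [/\ artinian k,
        forall c x, phi c * x = x * phi c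
      & exists n (g : 'I_n -> A), forall x, exists c : 'I_n -> k,
          x = \sum_(i < n) phi (c i) * g i].

(* Main.v *)
Require Import Defs.
From HB Require Import structures.
From mathcomp Require Import all_boot all_algebra.
From mathcomp Require Import boolp classical_sets.

(* Let I be a finitely generated injective cogenerator of left modules.  As id A
   is finite, so is the injective dimension of every syzygy of I, and condition
   (AC) for the single module I gives b with Ext^i(I, Omega^j I) = 0 for all
   i > b and all j.  In particular Ext^1(Omega^b I, Omega^(b+1) I) = 0, so
   Omega^b I is projective.  Let P be a resolution of a right module by finitely
   generated free modules.  The complex I (x) P is exact in degrees > b, hence so
   is Hom(P, A), because Hom(-, I) takes the latter to the former.  Thus
   Ext^i(-, A) = 0 for i > b on finitely generated right modules, and Baer's
   criterion shows that the b-th cosyzygy of A is injective.  Finally, over a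
   noetherian ring finite self-injective dimension bounds the finitistic
   dimension on the same side.

   No duality over k is used: both I and the injective right modules are
   essential extensions of maximal k-length of a finitely generated module, and
   that length is bounded by the Loewy filtration. *)

Set Implicit Arguments.
Unset Strict Implicit.
Unset Printing Implicit Defensive.

Import GRing.Theory.

Local Open Scope ring_scope.

(** * Submodules and quotients *)

(** Finite id A makes Ext^i(I, Omega^j I) vanish for large i, but from a degree that grows with j.
    (AC) fixes b before j is chosen, so j may be b + 1, and the syzygy sequence at Omega^b I splits.
    I then has projective dimension at most b, so its Tor vanishes above degree b against every
    right module; this is why one b serves all complexes P. A complex P is a sequence of matrices:
    acting on columns over A they are maps of free right modules, on columns over I they give I (x)
    P, on rows over A they give Hom(P, A). Lengths are taken over k because consecutive Loewy layers
    are compared by multiplication by elements of A, which is k-linear but in general not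
    A-linear. *)

Section Submodules.
Variable R : pzRingType.
Implicit Types V W : lmodType R.

Definition submod V (S : V -> Prop) : Prop :=
  S 0 /\ forall a x y, S x -> S y -> S (a *: x + y).

Section Closure.
Variables (V : lmodType R) (S : V -> Prop) (sS : submod S).

Lemma submodD x y : S x -> S y -> S (x + y).
Proof. by move=> Sx Sy; rewrite -[x]scale1r; apply: sS.2. Qed.

Lemma submodZ a x : S x -> S (a *: x).
Proof. by move=> Sx; rewrite -[_ *: _]addr0; apply: sS.2 => //; exact: sS.1. Qed.

Lemma submodN x : S x -> S (- x).
Proof. by move=> Sx; rewrite -scaleN1r; exact: submodZ. Qed.

Lemma submodB x y : S x -> S y -> S (x - y).
Proof. by move=> Sx /submodN; exact: submodD. Qed.

Lemma submod_sum (I : Type) (r : seq I) (P : pred I) (F : I -> V) :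
  (forall i, P i -> S (F i)) -> S (\sum_(i <- r | P i) F i).
Proof. by move=> SF; apply: big_ind => //; [exact: sS.1|exact: submodD]. Qed.

End Closure.

Definition adjoin V (S : V -> Prop) (x : V) : V -> Prop :=
  fun y => exists a s, S s /\ y = a *: x + s.

Lemma submod_adjoin V (S : V -> Prop) x : submod S -> submod (adjoin S x).
Proof.
move=> sS; split; first by exists 0, 0; rewrite scale0r addr0; split=> //; exact: sS.1.
move=> a _ _ [b [s [Ss ->]]] [c [t [St ->]]].
exists (a * b + c), (a *: s + t); split; first exact: sS.2.
by rewrite scalerDr scalerA scalerDl addrACA.
Qed.

Lemma adjoin_id V (S : V -> Prop) x : submod S -> adjoin S x x.
Proof. by move=> sS; exists 1, 0; rewrite scale1r addr0; split=> //; exact: sS.1. Qed.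

Lemma adjoin_sub V (S : V -> Prop) x y : S y -> adjoin S x y.
Proof. by move=> Sy; exists 0, y; rewrite scale0r add0r. Qed.

Lemma submod_ker V W (f : {linear V -> W}) : submod (fun x => f x = 0).
Proof. by split=> [|a x y fx fy]; rewrite ?linear0// linearP fx fy scaler0 addr0. Qed.

Lemma submod_preim V W (f : {linear V -> W}) (T : W -> Prop) :
  submod T -> submod (fun x => T (f x)).
Proof.
move=> sT; split=> [|a x y Tx Ty]; first by rewrite linear0; exact: sT.1.
by rewrite linearP; exact: sT.2.
Qed.

Lemma submod_image V W (f : {linear V -> W}) (S : V -> Prop) :
  submod S -> submod (fun y => exists2 x, S x & y = f x).
Proof.
move=> sS; split; first by exists 0; [exact: sS.1|rewrite linear0].
by move=> a _ _ [x Sx ->] [y Sy ->]; exists (a *: x + y); [exact: sS.2|rewrite linearP].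
Qed.

Lemma submodI V (S T : V -> Prop) :
  submod S -> submod T -> submod (fun x => S x /\ T x).
Proof.
move=> sS sT; split; first by split; [exact: sS.1|exact: sT.1].
by move=> a x y [Sx Tx] [Sy Ty]; split; [exact: sS.2|exact: sT.2].
Qed.

Lemma submod_all V (I : Type) (S : I -> V -> Prop) (P : I -> Prop) :
  (forall i, P i -> submod (S i)) -> submod (fun x => forall i, P i -> S i x).
Proof.
move=> sS; split=> [i Pi|a x y Sx Sy i Pi]; first exact: (sS i Pi).1.
by apply: (sS i Pi).2; [exact: Sx|exact: Sy].
Qed.

(** Zorn's lemma, with maximality in the form in which it is used: adjoining a new x to Z produces
    an element of T. *)
Lemma submod_maximal V (S T : V -> Prop) : submod S ->
  (forall x, S x -> ~ T x) ->
  exists Z : V -> Prop, [/\ submod Z, forall x, S x -> Z x,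
    forall x, Z x -> ~ T x
  & forall x, ~ Z x -> exists a z, Z z /\ T (a *: x + z)].
Proof.
move=> sS ST.
(* The empty chain also needs an upper bound, and its union is empty; joining S to Z lets the empty
   set satisfy P. *)
pose P (Z : set V) := [/\ submod (Z `|` S)%classic & forall x, Z x -> ~ T x].
have /Zorn_bigcup[Z [[sZ ZT] Zmax]] : forall F : set (set V), (F `<=` P)%classic ->
    total_on F subset -> P (\bigcup_(X in F) X)%classic.
  move=> F FP tF; split; last by move=> x [X FX Xx]; exact: (FP X FX).2.
  split=> [|a x y]; first by right; exact: sS.1.
  case=> [[X FX Xx]|Sx] [[Y FY Yy]|Sy].
  - have [XY|YX] := tF _ _ FX FY.
      have [||?|?] := (FP Y FY).1.2 a x y; [by left; exact: XY|by left| |by right].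
      by left; exists Y.
    have [||?|?] := (FP X FX).1.2 a x y; [by left|by left; exact: YX| |by right].
    by left; exists X.
  - have [||?|?] := (FP X FX).1.2 a x y; [by left|by right| |by right].
    by left; exists X.
  - have [||?|?] := (FP Y FY).1.2 a x y; [by right|by left| |by right].
    by left; exists Y.
  - by right; exact: sS.2.
exists (Z `|` S)%classic; split=> //; first by move=> x Sx; right.
  by move=> x [/ZT|/ST].
move=> x nZx; apply: contrapT => nT.
pose Y := adjoin (Z `|` S)%classic x.
have PY : P Y.
  split; last by move=> _ [a [z [Zz ->]]] Tz; apply: nT; exists a, z.
  suff -> : (Y `|` S)%classic = Y by exact: submod_adjoin.
  by apply/seteqP; split=> y; [case=> // Sy; apply: adjoin_sub; right|left].
apply: (Zmax Y) => //; split=> [y Zy|YZ]; first by apply: adjoin_sub; left.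
by apply: nZx; left; apply: YZ; exact: adjoin_id.
Qed.

End Submodules.

Section QuotientModule.
Variables (R : pzRingType) (V : lmodType R) (S : V -> Prop) (sS : submod S).

Definition quot_pred of submod S : {pred V} := fun x => `[< S x >].

Fact quot_zmod_closed : zmod_closed (quot_pred sS).
Proof.
split=> [|x y]; rewrite !unfold_in; first by apply/asboolP; exact: sS.1.
by move=> /asboolP Sx /asboolP Sy; apply/asboolP; exact: submodB.
Qed.

HB.instance Definition _ :=
  GRing.isZmodClosed.Build V (quot_pred sS) quot_zmod_closed.

Definition quotmod_of : Type := Quotient.quot (quot_pred sS).

HB.instance Definition _ := GRing.Zmodule.on quotmod_of.

Definition quot_pi (x : V) : quotmod_of := (\pi_(Quotient.quot (quot_pred sS)) x)%qT.

Lemma quot_piP x y : quot_pi x = quot_pi y <-> S (x - y).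
Proof.
split=> [/eqP|Sxy]; first by rewrite -Quotient.idealrBE => /asboolP.
by apply/eqP; rewrite -Quotient.idealrBE; apply/asboolP.
Qed.

Lemma quot_pi_surj : surjective quot_pi.
Proof. by move=> q; exists (repr q); rewrite /quot_pi reprK. Qed.

Definition quot_scale (a : R) (q : quotmod_of) : quotmod_of :=
  quot_pi (a *: (repr (q : Quotient.quot (quot_pred sS)))).

Lemma quot_scale_pi a x : quot_scale a (quot_pi x) = quot_pi (a *: x).
Proof.
apply/quot_piP; rewrite -scalerBr; apply: submodZ => //.
by apply/quot_piP; rewrite /quot_pi reprK.
Qed.

Fact quot_scalerA a b q : quot_scale a (quot_scale b q) = quot_scale (a * b) q.
Proof. by have [x <-] := quot_pi_surj q; rewrite !quot_scale_pi scalerA. Qed.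

Fact quot_scale1r : left_id 1 quot_scale.
Proof. by move=> q; have [x <-] := quot_pi_surj q; rewrite !quot_scale_pi scale1r. Qed.

Let quot_piD x y : quot_pi (x + y) = quot_pi x + quot_pi y.
Proof. by rewrite /quot_pi !piE. Qed.

Fact quot_scalerDr : right_distributive quot_scale +%R.
Proof.
move=> a p q; have [x <-] := quot_pi_surj p; have [y <-] := quot_pi_surj q.
by rewrite -quot_piD !quot_scale_pi -quot_piD scalerDr.
Qed.

Fact quot_scalerDl q : {morph quot_scale^~ q : a b / a + b}.
Proof.
move=> a b; have [x <-] := quot_pi_surj q.
by rewrite !quot_scale_pi -quot_piD scalerDl.
Qed.

HB.instance Definition _ := GRing.Zmodule_isLmodule.Build R quotmod_of
  quot_scalerA quot_scale1r quot_scalerDr quot_scalerDl.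

Definition quotmod : lmodType R := quotmod_of.

Fact quot_pi_linear : linear (quot_pi : V -> quotmod).
Proof. by move=> a x y; rewrite quot_piD -quot_scale_pi. Qed.

HB.instance Definition _ :=
  GRing.isLinear.Build R V quotmod *:%R quot_pi quot_pi_linear.

Definition quotproj : {linear V -> quotmod} := quot_pi.

Lemma quotproj_surj : surjective quotproj.
Proof. exact: quot_pi_surj. Qed.

Lemma quotproj_eq0 x : quotproj x = 0 <-> S x.
Proof. by rewrite -(linear0 quotproj) quot_piP subr0. Qed.

End QuotientModule.

(** * Graphs of partial linear maps and Baer's criterion *)

Section MakeLinear.
Variables (R : pzRingType) (V W : lmodType R) (f : V -> W) (lf : linear f).
Definition mklin_fun of linear f := f.
HB.instance Definition _ := GRing.isLinear.Build R V W *:%R (mklin_fun lf) lf.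
Definition mklin : {linear V -> W} := mklin_fun lf.
End MakeLinear.

Section Graphs.
Variable R : pzRingType.
Implicit Types V W K N Q : lmodType R.

Definition functional V W (G : V * W -> Prop) : Prop := forall w, G (0, w) -> w = 0.

Lemma functional_eq V W (G : V * W -> Prop) v w w' :
  submod G -> functional G -> G (v, w) -> G (v, w') -> w = w'.
Proof.
move=> sG fG Gw Gw'; apply/eqP; rewrite -subr_eq0; apply/eqP/fG.
by rewrite -(subrr v); exact: (submodB sG Gw Gw').
Qed.

Lemma linear_of_graph V W (G : V * W -> Prop) :
  submod G -> functional G -> (forall v, exists w, G (v, w)) ->
  exists g : {linear V -> W}, forall v w, G (v, w) <-> w = g v.
Proof.
move=> sG fG tG; pose g v := sval (cid (tG v)).
have Gg v : G (v, g v) by rewrite /g; case: cid.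
have lg : linear g.
  move=> a x y; apply: (functional_eq sG fG (Gg _)).
  exact: (sG.2 a _ _ (Gg x) (Gg y)).
exists (mklin lg) => v w; split=> [Gw|->]; last exact: Gg.
exact: (functional_eq sG fG Gw (Gg v)).
Qed.

Lemma factor_surj P K W (p : {linear P -> K}) (h : {linear P -> W}) :
  surjective p -> (forall x, p x = 0 -> h x = 0) ->
  exists g : {linear K -> W}, forall x, g (p x) = h x.
Proof.
move=> ps ph.
have [| | |g gE] := @linear_of_graph K W (fun z => exists x, z = (p x, h x)).
- split; first by exists 0; rewrite !linear0.
  by move=> a _ _ [x ->] [y ->]; exists (a *: x + y); rewrite !linearP.
- by move=> w [x [px ->]]; apply: ph.
- by move=> k; have [x <-] := ps k; exists (h x), x.
by exists g => x; apply/esym/gE; exists x.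
Qed.

Lemma factor_inj K N Q (i : {linear N -> Q}) (h : {linear K -> Q}) :
  injective i -> (forall x, exists n, h x = i n) ->
  exists g : {linear K -> N}, forall x, i (g x) = h x.
Proof.
move=> ii hi.
have [| | |g gE] := @linear_of_graph K N (fun z => h z.1 = i z.2) => //=.
- split=> [|a x y /= hx hy]; first by rewrite /= !linear0.
  by rewrite !linearP hx hy.
- by move=> n /=; rewrite linear0 -(linear0 i) => /ii.
by exists g => x; apply/esym/(gE x (g x)).
Qed.

(** A partial map into Q is encoded by its graph, whose domain is a left ideal; q is the value at 1
    of an extension to the whole ring. *)
Definition baer Q : Prop := forall G : R^o * Q -> Prop,
  submod G -> functional G -> exists q : Q, forall (a : R) x, G (a, x) -> x = a *: q.

(** Functional means disjoint from the pairs (0, w) with w nonzero, so [submod_maximal] applies. A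
    pair (v, w) is then missing from Z only if Z gives some multiple of v a value that contradicts
    w. *)
Lemma functional_maximal V W (G : V * W -> Prop) :
  submod G -> functional G ->
  exists Z : V * W -> Prop, [/\ submod Z, functional Z, forall z, G z -> Z z
    & forall v w, ~ Z (v, w) ->
      exists a w', Z (a *: v, w') /\ w' <> a *: w].
Proof.
move=> sG fG.
have [|Z [sZ GZ ZT Zmax]] :=
    @submod_maximal R (V * W)%type G (fun z => z.1 = 0 /\ z.2 <> 0) sG.
  by case=> v w Gw [/= v0]; rewrite v0 in Gw => /(_ (fG _ Gw)).
exists Z; split=> //.
  by move=> w Zw; apply: contrapT => w0; apply: (ZT _ Zw).
move=> v w /Zmax[a [[v' w'] [Zz [/= e]]]].
have v'E : v' = - (a *: v) by apply/eqP; rewrite -addr_eq0 addrC e.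
move=> ne; exists a, (- w'); split.
  have -> : (a *: v, - w') = - (v', w') by congr pair; rewrite /= v'E opprK.
  exact: submodN.
by move=> /eqP; rewrite eq_sym -addr_eq0 => /eqP.
Qed.

Lemma baer_graph Q : baer Q -> forall N (G : N * Q -> Prop),
  submod G -> functional G ->
  exists g : {linear N -> Q}, forall n q, G (n, q) -> q = g n.
Proof.
move=> bQ N G sG fG; have [Z [sZ fZ GZ Zmax]] := functional_maximal sG fG.
have [|g gE] := linear_of_graph sZ fZ; last by exists g => n q /GZ/gE.
(* Baer's criterion for the partial map a |-> Z(a n) yields q such that nothing in Z contradicts (n,
   q); maximality puts this pair into Z. *)
move=> n; have [| |q qE] := bQ (fun z => Z ((z.1 : R) *: n, z.2)).
- split=> /= [|a x y Zx Zy]; first by rewrite scale0r; exact: sZ.1.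
  by have := sZ.2 a _ _ Zx Zy; congr Z; congr pair; rewrite /= scalerA scalerDl.
- by move=> w /=; rewrite scale0r; exact: fZ.
exists q; apply: contrapT => /Zmax[a [w [Zw]]]; apply.
exact: qE.
Qed.

Lemma baer_injective Q : baer Q -> injective_module Q.
Proof.
move=> bQ M N j f ij.
have [| |g gE] := baer_graph bQ (G := fun z : N * Q => exists m, z = (j m, f m)).
- split; first by exists 0; rewrite !linear0.
  by move=> a _ _ [x ->] [y ->]; exists (a *: x + y); rewrite !linearP.
- by move=> w [m [e ->]]; rewrite (ij m 0) ?linear0.
by exists g => x; apply/esym/gE; exists x.
Qed.

End Graphs.

(** * Length *)

Section Length.
Variable R : pzRingType.
Implicit Types V W : lmodType R.

(** Length at most n, as a bound on strict descents: each passage to a proper submodule costs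
    one. *)
Fixpoint lenle V (n : nat) (S : V -> Prop) : Prop :=
  match n with
  | 0 => forall x, S x -> x = 0
  | m.+1 => forall T : V -> Prop, submod T -> (forall x, T x -> S x) ->
      (exists x, S x /\ ~ T x) -> lenle m T
  end.

Lemma lenle_sub V n (S T : V -> Prop) :
  (forall x, T x -> S x) -> lenle n S -> lenle n T.
Proof.
case: n => [|n] TS lS; first by move=> x /TS/lS.
move=> T' sT' T'T [x [Tx nT'x]]; apply: lS => //; first by move=> y /T'T/TS.
by exists x; split=> //; exact: TS.
Qed.

(** A proper submodule T either misses part of the kernel of f on S, and a drops, or contains that
    kernel; its image is then proper, and b drops. *)
Lemma lenle_add V W (f : {linear V -> W}) (S : V -> Prop) a b : submod S ->
  lenle a (fun x => S x /\ f x = 0) ->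
  lenle b (fun y => exists2 x, S x & y = f x) -> lenle (a + b) S.
Proof.
have [n] := ubnP (a + b)%N; elim: n => // n IH in a b S *; rewrite ltnS => abn sS.
have [/eqP|] := posnP (a + b).
  rewrite addn_eq0 => /andP[/eqP-> /eqP->] lK lI x Sx; apply: lK; split=> //.
  by apply: lI; exists x.
case abE: (a + b)%N => [//|m] _ lK lI T sT TS [x [Sx nTx]].
have [[y [[Sy fy] nTy]]|nK] := pselect (exists y, (S y /\ f y = 0) /\ ~ T y).
  case: a => [|a] in abn abE lK *.
    by have y0 := lK y (conj Sy fy); case: nTy; rewrite y0; exact: sT.1.
  have mE : m = (a + b)%N by case: abE.
  rewrite mE; apply: IH => //.
  - apply: lK; first exact: submodI sT (submod_ker f).
      by move=> z [/TS].
    by exists y; split=> // -[].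
  by apply: lenle_sub lI => _ [z /TS Sz ->]; exists z.
case: b => [|b] in abn abE lI *.
  by case: nK; exists x; split=> //; split=> //; apply: lI; exists x.
have mE : m = (a + b)%N by apply: succn_inj; rewrite -abE addnS.
rewrite mE; apply: IH => //.
- by move: abn; rewrite addnS.
- by apply: lenle_sub lK => z [/TS].
- apply: lI; first exact: submod_image.
    by move=> _ [z /TS Sz ->]; exists z.
  exists (f x); split; first by exists x.
  move=> [t Tt fxt]; apply: nK; exists (x - t); split.
    by split; [apply: submodB (TS _ Tt)|rewrite linearB fxt subrr].
  by move=> Txt; apply: nTx; rewrite -(subrK t x); exact: submodD.
Qed.

Lemma lenle_image V W (f : {linear V -> W}) (S : V -> Prop) n : submod S ->
  lenle n S -> lenle n (fun y => exists2 x, S x & y = f x).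
Proof.
elim: n => [|n IH] in S * => sS lS.
  by move=> _ [x /lS -> ->]; rewrite linear0.
move=> T sT TS [_ [[x Sx ->] nTx]].
have sT' : submod (fun x => S x /\ T (f x)) by apply: submodI => //; exact: submod_preim.
apply: lenle_sub (IH _ sT' _) => [y Ty|].
  by have [z Sz yE] := TS _ Ty; exists z => //; split=> //; rewrite -yE.
by apply: lS => // [z []//|]; exists x; split=> // -[].
Qed.

Lemma lenle_inj V W (f : {linear V -> W}) n : injective f ->
  lenle n (fun _ : W => True) -> lenle n (fun _ : V => True).
Proof.
move=> fi lW; rewrite -[n]add0n; apply: (lenle_add (f := f)) => //.
  by move=> x [_ fx]; apply: fi; rewrite linear0.
exact: lenle_sub lW.
Qed.

(** The maps g i embed S modulo their common kernel into a power of T. *)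
Lemma lenle_family V W (I : eqType) (g : I -> {linear V -> W}) (r : seq I)
    (S : V -> Prop) (T : W -> Prop) n c :
  submod S -> lenle n T -> (forall i x, S x -> T (g i x)) ->
  lenle c (fun x => S x /\ forall i, i \in r -> g i x = 0) ->
  lenle (c + size r * n) S.
Proof.
move=> sS lT gST; elim: r => [|i r IH] in S sS gST * => lK.
  by rewrite addn0; apply: lenle_sub lK.
rewrite [size _]/= mulSn [(n + _)%N]addnC addnA; apply: (lenle_add (f := g i)) => //.
  apply: IH; first exact: submodI sS (submod_ker _).
    by move=> j x [/gST].
  apply: lenle_sub lK => x [[Sx gx] gr]; split=> // j; rewrite inE => /orP[/eqP->//|].
  exact: gr.
by apply: lenle_sub lT => _ [x Sx ->]; exact: gST.
Qed.

Lemma lenle_min V n (S : V -> Prop) (F : (V -> Prop) -> Prop) : lenle n S -> F S ->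
  (forall T, F T -> submod T) ->
  exists T, [/\ F T, forall x, T x -> S x
    & forall T', F T' -> (forall x, T' x -> T x) -> forall x, T x -> T' x].
Proof.
move=> lS FS sF; elim: n => [|n IH] in S lS FS *.
  by exists S; split=> // T' /sF[T'0 _] _ x /lS ->.
have [[T' [FT' T'S]]|nT'] := pselect (exists T', [/\ F T', forall x, T' x -> S x
    & exists x, S x /\ ~ T' x]).
  move=> T'p; have [T [FT TT' Tm]] := IH T' (lS _ (sF _ FT') T'S T'p) FT'.
  by exists T; split=> // x /TT'/T'S.
exists S; split=> // T' FT' T'S x Sx; apply: contrapT => nT'x; apply: nT'.
by exists T'; split=> //; exists x.
Qed.

Lemma lenle_acc V n (T : nat -> V -> Prop) : lenle n (fun _ : V => True) ->
  (forall i, submod (T i)) -> (forall i x, T i x -> T i.+1 x) ->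
  exists r, forall x, T r.+1 x -> T r x.
Proof.
move=> lV sT Tinc; apply: contrapT => nr.
have Tp i : exists x, T i.+1 x /\ ~ T i x.
  apply: contrapT => nx; apply: nr; exists i => x Tx; apply: contrapT => nTx.
  by apply: nx; exists x.
suff nl m : ~ lenle m (T m.+1) by apply: (nl n); exact: lenle_sub lV.
elim: m => [|m IH] lT; last by apply: IH; exact: (lT _ (sT _) (Tinc _) (Tp _)).
by have [x [/lT x0 nTx]] := Tp 0%N; apply: nTx; rewrite x0; exact: (sT _).1.
Qed.

Definition fg_sub V (S : V -> Prop) : Prop :=
  exists n (g : 'I_n -> V), (forall i, S (g i)) /\
    forall x, S x -> exists c : 'I_n -> R, x = \sum_(i < n) c i *: g i.

(** Otherwise, adjoining missing elements one at a time gives finitely generated submodules of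
    length beyond any bound. *)
Lemma lenle_fg V n (S : V -> Prop) : lenle n S -> submod S -> fg_sub S.
Proof.
move=> lS sS; apply: contrapT => nfg.
suff nl m : exists T : V -> Prop, [/\ submod T, fg_sub T, forall x, T x -> S x & ~ lenle m T].
  by have [T [_ _ TS]] := nl n; apply; exact: lenle_sub lS.
have next T : submod T -> fg_sub T -> (forall x, T x -> S x) ->
    exists x, [/\ S x, ~ T x & fg_sub (adjoin T x)].
  move=> sT fT TS.
  have [x [Sx nTx]] : exists x, S x /\ ~ T x.
    apply: contrapT => nx; apply: nfg; suff <- : T = S by [].
    apply/funext => x; apply/propext; split=> [/TS//|Sx]; apply: contrapT => nTx.
    by apply: nx; exists x.
  exists x; split=> //; have [p [g [Tg gT]]] := fT.
  exists p.+1, (fun i => if unlift ord0 i is Some j then g j else x); split.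
    by move=> i; case: unliftP => [j|] _; [exact: adjoin_sub|exact: adjoin_id].
  move=> _ [a [t [/gT[c ->] ->]]].
  exists (fun i => if unlift ord0 i is Some j then c j else a).
  rewrite big_ord_recl unlift_none; congr (_ + _).
  by apply: eq_bigr => i _; rewrite liftK.
have adS T x : (forall x, T x -> S x) -> S x -> forall y, adjoin T x y -> S y.
  by move=> TS Sx _ [a [t [/TS St ->]]]; exact: sS.2.
elim: m => [|m [T [sT fT TS nl]]].
  pose Z := fun x : V => x = 0.
  have sZ : submod Z by split=> // a x y -> ->; rewrite scaler0 addr0.
  have ZS x : Z x -> S x by move=> ->; exact: sS.1.
  have [|x [Sx nx fx]] := next Z sZ _ ZS.
    exists 0%N, (fun=> 0); split=> // x ->; exists (fun=> 0).
    by rewrite big_ord0.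
  exists (adjoin Z x); split=> //; [exact: submod_adjoin|exact: adS|].
  by move=> /(_ x (adjoin_id _ sZ)).
have [x [Sx nx fx]] := next T sT fT TS.
exists (adjoin T x); split=> //; [exact: submod_adjoin|exact: adS|].
move=> /(_ T sT) l; apply: nl; apply: l; first exact: adjoin_sub.
by exists x; split=> //; exact: adjoin_id.
Qed.

End Length.

(** * Artinian commutative rings have finite length *)

Section ArtinianLength.
Variables (k : comPzRingType) (ak : artinian k).
Implicit Types I T : k^o -> Prop.

Lemma artinian_min (F : (k^o -> Prop) -> Prop) I : F I -> (forall T, F T -> submod T) ->
  exists T, F T /\ forall T', F T' -> (forall x, T' x -> T x) -> forall x, T x -> T' x.
Proof.
move=> FI sF; apply: contrapT => nmin.
have nx (T : {T | F T}) : exists T' : {T | F T},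
    (forall x, sval T' x -> sval T x) /\ exists x, sval T x /\ ~ sval T' x.
  case: T => T FT; apply: contrapT => nT; apply: nmin; exists T; split=> // T' FT' T'T x Tx.
  apply: contrapT => nT'x; apply: nT; exists (exist _ T' FT'); split=> //.
  by exists x.
pose c n := iter n (fun T : {T | F T} => sval (cid (nx T))) (exist _ I FI).
have cS n : (forall x, sval (c n.+1) x -> sval (c n) x) /\
    exists x, sval (c n) x /\ ~ sval (c n.+1) x by rewrite /=; case: cid.
have [||n /(_ n.+1 (leqnSn n)) nP] := ak (I := fun n => (fun x => `[< sval (c n) x >]) : {pred k^o}).
- move=> n; have [s0 sD] := sF _ (svalP (c n)); split; rewrite ?unfold_in.
    exact/asboolP.
  by move=> a x y; rewrite !unfold_in => /asboolP ? /asboolP ?; apply/asboolP; exact: sD.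
- by move=> n x; rewrite !unfold_in => /asboolP/(cS n).1/asboolP.
have [_ [x [cx ncx]]] := cS n; apply: ncx.
by have := nP x; rewrite !unfold_in (asboolT cx) => /asboolP.
Qed.

(* Let I be minimal among the ideals of infinite length. Every a in k either
   kills I or satisfies a I = I, so P = ann I is prime and k / P is a field, and
   a hyperplane W of the k / P-space I has finite length. *)
Lemma artinian_finite_length : exists n, lenle n (fun _ : k^o => True).
Proof.
apply: contrapT => nl; pose F I := submod I /\ ~ exists n, lenle n I.
have [|T []//|I [[sI nlI] Imin]] := @artinian_min F (fun=> True); first by [].
have fin T : submod T -> (forall x, T x -> I x) -> (exists x, I x /\ ~ T x) ->
    exists n, lenle n T.
  move=> sT TI [x [Ix nTx]]; apply: contrapT => nlT; apply: nTx.
  exact: Imin Ix.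
have act (a : k) : (forall x, I x -> a * x = 0) \/ (forall x, I x -> exists2 y, I y & x = a * y).
  pose f : {linear k^o -> k^o} := GRing.scale a.
  have [fI|nfI] := pselect (forall x, I x -> a * x = 0); [by left|right].
  apply: contrapT => naI.
  have [m lm] : exists m, lenle m (fun y => exists2 x, I x & y = f x).
    apply: fin; first exact: submod_image.
      by move=> _ [x Ix ->]; exact: submodZ.
    apply: contrapT => nx; apply: naI => x Ix; apply: contrapT => naIx.
    by apply: nx; exists x.
  have [p lp] : exists p, lenle p (fun x => I x /\ f x = 0).
    apply: fin; [exact: submodI sI (submod_ker f)|by move=> x []|].
    apply: contrapT => nx; apply: nfI => x Ix; apply: contrapT => ax.
    by apply: nx; exists x; split=> // -[].
  by apply: nlI; exists (p + m)%N; apply: lenle_add lm.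
have inv (a : k) : (exists2 x, I x & a * x <> 0) ->
    exists c : k, forall x, I x -> c * a * x = x.
  move=> [x Ix ax].
  have aI : forall x, I x -> exists2 y, I y & x = a * y.
    by case: (act a) => // /(_ _ Ix).
  have aIn n : forall x, I x -> exists2 y, I y & x = a ^+ n * y.
    elim: n => [|n IH] y Iy; first by exists y => //; rewrite expr0 mul1r.
    have [z Iz ->] := IH _ Iy; have [t It ->] := aI _ Iz.
    by exists t => //; rewrite exprSr mulrA.
  (* The chain of ideals (a^n) stops, so a^n = c a^(n+1) for some c, and on I = a^n I this c inverts
     a. *)
  pose An n := fun y : k^o => exists c : k, y = c * a ^+ n.
  have [|_ [m ->]|An0 [[n ->] mn]] := @artinian_min (fun T => exists n, T = An n) (An 0%N).
  - by exists 0%N.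
  - split; first by exists 0; rewrite mul0r.
    by move=> b _ _ [c ->] [d ->]; exists (b * c + d); rewrite mulrDl -mulrA.
  have [|_ [c ->]||c cE] := mn (An n.+1) _ _ (a ^+ n).
  - by exists n.+1.
  - by exists (c * a); rewrite exprS mulrA.
  - by exists 1; rewrite mul1r.
  exists c => y /(aIn n)[z Iz ->].
  by rewrite [in RHS]cE exprS !mulrA.
have [x [Ix x0]] : exists x, I x /\ x <> 0.
  apply: contrapT => nx; apply: nlI; exists 0%N => x Ix; apply: contrapT => x0.
  by apply: nx; exists x.
(* The hyperplane is the intersection of I with W, an ideal maximal among those missing x. It is
   proper in I, hence of finite length. For y in I outside W, x = c y + w with c invertible on I, so
   I lies in W + k x. *)
have [||W [sW _ Wx Wmax]] := @submod_maximal k k^o (fun y => y = 0) (fun y => y = x).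
- by split=> // a y z -> ->; rewrite scaler0 addr0.
- by move=> _ -> /esym.
have [m lm] : exists m, lenle m (fun y => I y /\ W y).
  apply: fin; [exact: submodI|by move=> y []|exists x; split=> // -[_ /Wx]].
  exact.
have [p lp] : exists p, lenle p (fun y => exists c, y = c *: x :> k^o).
  exists 1%N => T sT Tx [_ [[c ->] nTc]] z Tz; apply: contrapT => z0.
  have [d zE] := Tx _ Tz; have [|e eE] := inv d; first by exists x => //; rewrite -[d * x]zE.
  apply: nTc; apply: submodZ => //.
  by rewrite -(eE _ Ix) -mulrA -[d * x]zE; exact: submodZ.
apply: nlI; exists (m + p)%N; apply: (lenle_add (f := quotproj sW)) => //.
  by apply: lenle_sub lm => y [Iy /quotproj_eq0 Wy].
have skx : submod (fun y : k^o => exists c, y = c *: x :> k^o).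
  split; first by exists 0; rewrite scale0r.
  by move=> a _ _ [c ->] [d ->]; exists (a * c + d); rewrite scalerDl scalerA.
apply: lenle_sub (lenle_image (quotproj sW) skx lp) => _ [y Iy ->].
have [Wy|/Wmax[c [w [Ww xE]]]] := pselect (W y).
  exists 0; first by exists 0; rewrite scale0r.
  by rewrite linear0; apply/quotproj_eq0.
have Iw : I w by rewrite -[w](addKr (c *: y)) xE addrC; apply: submodB => //; exact: submodZ.
have cy : c * y <> 0 by move=> cy; apply: Wx Ww _; rewrite -xE -[c *: y]/(c * y) cy add0r.
have [|d dE] := inv c; first by exists y.
exists (d *: x); first by exists d.
apply/quot_piP; rewrite -xE scalerDr opprD addrA.
have -> : d *: (c *: y) = y :> k^o by rewrite scalerA; exact: dE.
by rewrite subrr sub0r; apply: submodN => //; exact: submodZ.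
Qed.

End ArtinianLength.

(** * Finitely generated modules over rings of finite length *)

Section FiniteFree.
Variable R : pzRingType.
Implicit Types V W : lmodType R.

Section Lift.
Variables (V : lmodType R) (n : nat) (g : 'I_n -> V).

Fact rv_lift_linear : linear (fun v : 'rV[R]_n => \sum_i v 0 i *: g i).
Proof.
move=> a u v; rewrite scaler_sumr -big_split; apply: eq_bigr => i _.
by rewrite !mxE scalerDl scalerA.
Qed.

Definition rv_lift : {linear 'rV[R]_n -> V} := mklin rv_lift_linear.

Lemma rv_liftE v : rv_lift v = \sum_i v 0 i *: g i. Proof. by []. Qed.

End Lift.

Lemma fg_rv V : finitely_generated V ->
  exists n (p : {linear 'rV[R]_n -> V}), surjective p.
Proof.
move=> [n [g gV]]; exists n, (rv_lift g) => x; have [c ->] := gV x.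
by exists (\row_i c i); rewrite rv_liftE; apply: eq_bigr => i _; rewrite mxE.
Qed.

Lemma rv_linear_sum V n (f : {linear 'rV[R]_n -> V}) v :
  f v = \sum_i v 0 i *: f (delta_mx 0 i).
Proof.
rewrite {1}[v]row_sum_delta linear_sum; apply: eq_bigr => i _.
by rewrite linearZ.
Qed.

Lemma fg_surj V W (p : {linear V -> W}) : surjective p ->
  finitely_generated V -> finitely_generated W.
Proof.
move=> ps [n [g gV]]; exists n, (p \o g) => y; have [x <-] := ps y.
have [c ->] := gV x; exists c; rewrite linear_sum; apply: eq_bigr => i _.
by rewrite linearZ.
Qed.

Lemma fg_rV n : finitely_generated ('rV[R]_n : lmodType R).
Proof.
by exists n, (fun i => delta_mx 0 i) => v; exists (v 0); exact: row_sum_delta.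
Qed.

Fact rv_coord_linear n i : linear (fun v : 'rV[R]_n => v 0 i : R^o).
Proof. by move=> a u v; rewrite !mxE. Qed.

Lemma fg_self : finitely_generated (R^o : lmodType R).
Proof. by exists 1%N, (fun=> 1) => x; exists (fun=> x); rewrite big_ord1 [RHS]mulr1. Qed.

Definition finite_length : Prop := exists n, lenle n (fun _ : R^o => True).

Lemma fg_lenle V : finite_length -> finitely_generated V ->
  exists n, lenle n (fun _ : V => True).
Proof.
move=> [l lR] /fg_rv[n [p ps]].
have: exists m, lenle m (fun _ : 'rV[R]_n => True).
  exists (0 + size (enum 'I_n) * l)%N.
  apply: (lenle_family (g := fun i => mklin (@rv_coord_linear n i)) (T := fun=> True)) => //.
  move=> v [_ v0]; apply/rowP => i; rewrite mxE.
  by rewrite -[LHS]/(mklin (@rv_coord_linear n i) v) v0// mem_enum.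
move=> [m lm]; exists m; apply: lenle_sub (lenle_image p _ lm) => // y _.
by have [x <-] := ps y; exists x.
Qed.

Hypothesis fR : finite_length.

Lemma finite_length_fg_sub V (S : V -> Prop) :
  finitely_generated V -> submod S -> fg_sub S.
Proof.
move=> /(fg_lenle fR)[n lV] sS; apply: lenle_fg sS; exact: lenle_sub lV.
Qed.

Lemma finite_length_fg_inj V W (f : {linear V -> W}) :
  injective f -> finitely_generated W -> finitely_generated V.
Proof.
move=> fi /(fg_lenle fR)[n lW].
have [//|//|m [g [_ gV]]] := @lenle_fg _ V n (fun=> True).
  exact: lenle_inj fi lW.
by exists m, g => x; apply: gV.
Qed.

End FiniteFree.

(** * The Jacobson radical *)

Section Radical.
Variable R : pzRingType.

Definition maxl (m : R^o -> Prop) : Prop :=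
  [/\ submod m, ~ m 1 & forall a : R, ~ m a -> exists b : R, m (1 - b * a)].

Definition jac (a : R) : Prop := forall m, maxl m -> m a.

Lemma submod_jac : submod (jac : R^o -> Prop).
Proof. by apply: (@submod_all _ R^o _ (fun m => m)) => m []. Qed.

(** For m maximal and b outside m, the left ideal of all c with c b in m is again maximal. *)
Lemma jacMr a b : jac a -> jac (a * b).
Proof.
move=> ja m [sm m1 mm]; have [mb|nmb] := pselect (m b).
  exact: (submodZ sm (a : R) mb).
apply: (ja (fun c => m (c * b))); split.
- split=> [|c x y mx my]; first by rewrite mul0r; exact: sm.1.
  by rewrite mulrDl -mulrA; exact: sm.2.
- by rewrite mul1r.
move=> c /mm[d mdcb]; exists (b * d).
have := submodZ sm b mdcb; congr m.
by rewrite -[LHS]/(b * _) mulrBr mulrBl mul1r mulr1 !mulrA.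
Qed.

Lemma maxl_ann (V : lmodType R) (T : V -> Prop) x : submod T -> ~ T x ->
  (forall a : R, ~ T (a *: x) -> exists b : R, T (x - (b * a) *: x)) ->
  maxl (fun a : R => T (a *: x)).
Proof.
move=> sT nTx Tm; split.
- split=> [|a b c Tb Tc]; first by rewrite scale0r; exact: sT.1.
  by rewrite scalerDl -scalerA; exact: sT.2.
- by rewrite scale1r.
by move=> a /Tm[b Tb]; exists b; rewrite scalerBl scale1r.
Qed.

Hypothesis fR : finite_length R.

(** K is minimal among the left ideals with K + L = R; modulo jac, right multiplication by e
    projects onto K along L. If x in both K and L were outside a maximal m, then 1 - b x would lie
    in m for some b, and e (1 - b x) would make the intersection of K and m a smaller supplement. *)
Lemma jac_supplement (L : R^o -> Prop) : submod L ->
  exists (K : R^o -> Prop) e, [/\ submod K, K e, L (1 - e) &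
    forall x, K x -> L x -> jac x].
Proof.
move=> sL; have [n lR] := fR.
pose F (K : R^o -> Prop) := submod K /\ exists e : R, K e /\ L (1 - e).
have [||K [[sK [e [Ke Le]]] _ Kmin]] := @lenle_min R R^o n (fun=> True) F lR.
- by split=> //; exists 1; rewrite subrr; split=> //; exact: sL.1.
- by move=> T [].
exists K, e; split=> // x Kx Lx m [sm m1 mm]; apply: contrapT => /mm[b mb].
have FK : F (fun y => K y /\ m y).
  split; first exact: submodI.
  exists (e * (1 - b * x)); split; first split.
  - rewrite mulrBr mulr1 mulrA.
    exact: (submodB sK Ke (submodZ sK (e * b) Kx)).
  - exact: (submodZ sm e mb).
  rewrite mulrBr mulr1 opprB addrA addrAC mulrA.
  exact: (submodD sL Le (submodZ sL (e * b) Lx)).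
have [_ mx] := Kmin _ FK (fun y Ky => Ky.1) x Kx.
apply: m1; rewrite -(subrK (b * x) 1).
exact: (submodD sm mb (submodZ sm b mx)).
Qed.

(** The class of e in R / jac has annihilator m, so the simple module R / m embeds into R / jac. *)
Lemma socle_generator (m : R^o -> Prop) : maxl m ->
  exists e : R, forall a : R, jac (a * e) <-> m a.
Proof.
move=> mm; have [sm m1 mx] := mm; have [K [e [sK Ke me KJ]]] := jac_supplement sm.
exists e => a; split=> [|ma].
  move=> /(_ _ mm) mae; rewrite -[a](subrK (a * e)) -{1}[a]mulr1 -mulrBr.
  exact: (submodD sm (submodZ sm a me) mae).
apply: KJ; first exact: (submodZ sK a Ke).
rewrite -[a * e](subrK a) -[X in _ - X]mulr1 -mulrBr -opprB mulrN.
exact: (submodD sm (submodN sm (submodZ sm a me)) ma).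
Qed.

(** The elements killed by the i-th power of jac: the i-th term of the Loewy series. *)
Fixpoint jac_ann (X : lmodType R) (i : nat) (x : X) : Prop :=
  match i with
  | 0 => x = 0
  | i'.+1 => forall j, jac j -> jac_ann i' (j *: x)
  end.

Lemma jac_annD (X : lmodType R) i a (x y : X) :
  jac_ann i x -> jac_ann i y -> jac_ann i (a *: x + y).
Proof.
elim: i => [|i IH] in a x y * => /=; first by move=> -> ->; rewrite scaler0 addr0.
move=> jx jy j Jj; rewrite scalerDr scalerA -[_ *: x]scale1r.
by apply: IH; [exact: (jx _ (jacMr a Jj))|exact: (jy _ Jj)].
Qed.

Lemma submod_jac_ann (X : lmodType R) i : submod (@jac_ann X i).
Proof.
split; last by move=> a x y; exact: jac_annD.
by elim: i => [|i IH] //= j _; rewrite scaler0.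
Qed.

Lemma jac_annS (X : lmodType R) i (x : X) : jac_ann i x -> jac_ann i.+1 x.
Proof.
elim: i x => [|i IH] x; first by move=> -> j _ /=; rewrite scaler0.
by move=> jx j /jx/IH.
Qed.

(** The Loewy series of R stops at some r. If it stopped below R, the quotient of R by this term
    would have a simple submodule; jac kills it, so the series would still grow. *)
Lemma jac_nilpotent : exists r, forall (X : lmodType R) (x : X), jac_ann r x.
Proof.
have [n lR] := fR.
have [r Tr] := lenle_acc lR (fun i => submod_jac_ann R^o i) (fun i x => @jac_annS R^o i x).
exists r => X x; suff T1 : @jac_ann R^o r 1.
  have jax (a : R) : @jac_ann R^o r a -> jac_ann r (a *: x).
    elim: (r) a => [|i IH] a /= ja; first by rewrite ja scale0r.
    by move=> j /ja/IH; rewrite scalerA.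
  by rewrite -[x]scale1r; exact: jax.
pose F (T : R^o -> Prop) := submod T /\ (forall a, @jac_ann R^o r a -> T a) /\ exists x, T x /\ ~ @jac_ann R^o r x.
apply: contrapT => T1; have [||T [[sT [rT [t [Tt nt]]]] _ Tmin]] := @lenle_min R R^o n (fun=> True) F lR.
- by split=> //; split=> //; exists 1.
- by move=> S [].
apply: nt; apply: Tr => j; apply: contrapT; apply/not_implyP => -[Jj] njt.
have sr := submod_jac_ann R^o r; apply: njt.
have [//|nt] := pselect (@jac_ann R^o r (j * t)).
suff /Jj : maxl (fun a : R => @jac_ann R^o r (a *: (t : R^o))) by [].
apply: maxl_ann => //; first by move=> rt; apply: nt; exact: (submodZ sr j rt).
move=> a nat'.
have [||b [s [rs tE]]] := Tmin (adjoin (@jac_ann R^o r) (a *: (t : R^o))) _ _ t Tt.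
- split; first exact: submod_adjoin.
  split; first by move=> b; exact: adjoin_sub.
  by exists (a *: (t : R^o)); split=> //; exact: adjoin_id.
- by move=> _ [b [s [/rT Ts ->]]]; apply: sT.2 => //; exact: submodZ.
by exists b; rewrite -scalerA {1}tE [b *: _ + s]addrC addrK.
Qed.

End Radical.

(** * Essential extensions and injective hulls *)

Section Essential.
Variable R : pzRingType.
Implicit Types U X Y : lmodType R.

Definition essential U X (u : {linear U -> X}) : Prop :=
  injective u /\ forall x, x <> 0 -> exists a w, a *: x = u w /\ u w <> 0.

Lemma essential_id U : essential (idfun : {linear U -> U}).
Proof. by split=> // x x0; exists 1, x; rewrite scale1r. Qed.

Lemma essential_comp U X Y (u : {linear U -> X}) (v : {linear X -> Y}) :
  essential u -> essential v -> essential (v \o u : {linear U -> Y}).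
Proof.
move=> [iu eu] [iv ev]; split=> [|y]; first exact: inj_comp.
move=> /ev[a [x [ayE vx0]]]; have [|b [w [bxE uw0]]] := eu x.
  by move=> x0; apply: vx0; rewrite x0 linear0.
exists (b * a), w; rewrite -scalerA ayE -linearZ bxE; split=> //=.
by rewrite -(linear0 v) => /iv.
Qed.

(** Let K, e be a supplement of the ideal L of all a with a x in U. If e x = 0, then x = (1 - e) x
    is in U. Otherwise some a e x is nonzero and in U; but then a e lies in K and L, hence in jac,
    and kills x. *)
Lemma essential_socle U X (u : {linear U -> X}) x : finite_length R ->
  essential u -> (forall j, jac j -> j *: x = 0) -> exists w, x = u w.
Proof.
move=> fR [iu eu] Jx; pose L (a : R^o) := exists w, (a : R) *: x = u w.
have sL : submod L.
  split; first by exists 0; rewrite scale0r linear0.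
  move=> a b c [w bE] [w' cE]; exists (a *: w + w').
  by rewrite linearP -bE -cE scalerDl scalerA.
have [K [e [sK Ke [w eE] KJ]]] := jac_supplement fR sL.
have [ex0|/eu[a [w' [aE]]]] := pselect (e *: x = 0).
  by exists w; rewrite -eE scalerBl scale1r ex0 subr0.
rewrite -aE => -[]; rewrite scalerA; apply: Jx; apply: KJ.
  exact: (submodZ sK a Ke).
by exists w'; rewrite -scalerA.
Qed.

End Essential.

(** * Lengths over the base ring and essential extensions of bounded length *)

Section RestrictScalars.
Variables (k A : pzRingType) (phi : {rmorphism k -> A}).
Hypothesis phiC : forall c x, phi c * x = x * phi c.
Implicit Types U V W X Y : lmodType A.

Section Scale.
Variable V : lmodType A.

Definition resc_of of lmodType A : Type := V.
HB.instance Definition _ := GRing.Zmodule.on (resc_of V).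

Definition resc_scale (c : k) (x : resc_of V) : resc_of V := phi c *: (x : V).

Fact resc_scalerA c d x : resc_scale c (resc_scale d x) = resc_scale (c * d) x.
Proof. by rewrite /resc_scale scalerA rmorphM. Qed.
Fact resc_scale1r : left_id 1 resc_scale.
Proof. by move=> x; rewrite /resc_scale rmorph1 scale1r. Qed.
Fact resc_scalerDr : right_distributive resc_scale +%R.
Proof. by move=> c x y; exact: scalerDr. Qed.
Fact resc_scalerDl x : {morph resc_scale^~ x : c d / c + d}.
Proof. by move=> c d; rewrite /resc_scale rmorphD scalerDl. Qed.

HB.instance Definition _ := GRing.Zmodule_isLmodule.Build k (resc_of V)
  resc_scalerA resc_scale1r resc_scalerDr resc_scalerDl.

Definition resc : lmodType k := resc_of V.

Lemma resc_scaleE c (x : V) : c *: (x : resc) = phi c *: x. Proof. by []. Qed.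

End Scale.

Fact resc_map_linear V W (f : {linear V -> W}) : linear (f : resc V -> resc W).
Proof. by move=> c x y; rewrite [LHS]linearP. Qed.

Definition resc_map V W (f : {linear V -> W}) : {linear resc V -> resc W} :=
  mklin (resc_map_linear f).

Fact resc_act_linear V (a : A) : linear ((fun x => a *: (x : V)) : resc V -> resc V).
Proof. by move=> c x y; rewrite [LHS]scalerDr resc_scaleE scalerA -phiC -scalerA. Qed.

Definition resc_act V (a : A) : {linear resc V -> resc V} :=
  mklin (@resc_act_linear V a).

Lemma submod_resc V (S : V -> Prop) : submod S -> submod (S : resc V -> Prop).
Proof. by move=> sS; split; [exact: sS.1|move=> c x y; exact: sS.2]. Qed.

Lemma lenle_resc V n (S : V -> Prop) : lenle n (S : resc V -> Prop) -> lenle n S.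
Proof.
elim: n S => // n IH S lS T sT TS Tp; apply: IH; apply: lS => //; exact: submod_resc.
Qed.

Lemma fg_resc V : finitely_generated (resc (A^o : lmodType A)) ->
  finitely_generated V -> finitely_generated (resc V).
Proof.
move=> [n [g gA]] [m [h hV]].
exists #|{: 'I_m * 'I_n}|, (fun i => (g (enum_val i).2 : A) *: h (enum_val i).1) => x.
have [c ->] := hV x; pose d i := sval (cid (gA (c i))).
have dE i : c i = \sum_(j < n) phi (d i j) * g j by rewrite /d; case: cid => /= ? ->.
exists (fun i => d (enum_val i).1 (enum_val i).2).
under eq_bigr do rewrite dE scaler_suml.
rewrite pair_bigA /=.
rewrite (reindex (enum_val : 'I_#|{: 'I_m * 'I_n}| -> 'I_m * 'I_n)) /=; last first.
  by apply: onW_bij; exact: enum_val_bij.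
by apply: eq_bigr => i _; rewrite -scalerA.
Qed.

Hypotheses (fk : finite_length k) (fA : finitely_generated (resc (A^o : lmodType A))).

Lemma fg_lenle_resc V : finitely_generated V ->
  exists n, lenle n (fun _ : resc V => True).
Proof. by move=> /(fg_resc fA)/(fg_lenle fk). Qed.

Lemma finite_length_resc : finite_length A.
Proof. by have [n /lenle_resc lA] := fg_lenle_resc (fg_self A); exists n. Qed.

(** If the g q generate jac over k, the k-linear maps x |-> g q x have common kernel [jac_ann 1] and
    send [jac_ann i.+1] into [jac_ann i]. The bound depends on c and i only, not on V. *)
Lemma jac_ann_bound c i : exists n, forall V,
  lenle c (@jac_ann A V 1 : resc V -> Prop) -> lenle n (@jac_ann A V i : resc V -> Prop).
Proof.
have [p [g [gJ Jg]]] := finite_length_fg_sub fk fA (submod_resc (submod_jac A)).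
elim: i => [|i [n IH]]; first by exists 0%N => V _ x.
exists (c + size (enum 'I_p) * n)%N => V lV.
apply: (lenle_family (g := fun j => resc_act V (g j)) (T := @jac_ann A V i)).
- exact/submod_resc/submod_jac_ann.
- exact: IH.
- by move=> j x Jx; exact: Jx (gJ j).
apply: lenle_sub lV => x [_ gx] j /Jg[d ->] /=.
rewrite scaler_suml big1// => q _; rewrite -scalerA.
have -> : (g q : A) *: (x : V) = 0 by apply: gx; rewrite mem_enum.
exact: scaler0.
Qed.

(** The socle [jac_ann 1] of X lies in the image of U, which bounds its length independently of X;
    nilpotency of jac bounds the rest. *)
Lemma essential_bound (U : lmodType A) : finitely_generated U ->
  exists n, forall X (u : {linear U -> X}), essential u -> lenle n (fun _ : resc X => True).
Proof.
have fA' := finite_length_resc.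
move=> /fg_lenle_resc[c lU]; have [r rP] := jac_nilpotent fA'.
have [n nP] := jac_ann_bound c r; exists n => X u eu.
apply: (@lenle_sub k (resc X) n (@jac_ann A X r)) => [x _|]; first exact: rP.
apply: nP; apply: lenle_sub (lenle_image (resc_map u) _ lU) => // x Jx.
by have [w ->] := essential_socle fA' eu Jx; exists w.
Qed.

(* An essential extension X of U of maximal length is injective: enlarge a
   functional graph G in A x X to a maximal one Z; then (A x X) / Z is an
   essential extension of X, so it equals X and (1, q) lies in Z for some q. *)
Lemma essential_baer (U : lmodType A) : finitely_generated U ->
  exists X (u : {linear U -> X}), [/\ essential u, finitely_generated X & baer X].
Proof.
move=> /essential_bound[N lN].
have [X [u [eu umax]]] : exists X (u : {linear U -> X}), essential u /\
    forall Y (v : {linear X -> Y}), essential v -> surjective v.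
  apply: contrapT => nmax.
  have next X (u : {linear U -> X}) : essential u ->
      exists Y (v : {linear X -> Y}) y, essential v /\ forall x, v x <> y.
    move=> eu; apply: contrapT => nY; apply: nmax; exists X, u; split=> // Y v ev y.
    by apply: contrapT => ny; apply: nY; exists Y, v, y; split=> // x vx; apply: ny; exists x.
  suff grow m : exists X (u : {linear U -> X}), essential u /\
      ~ lenle m (fun _ : resc X => True).
    by have [X [u [/lN lX]]] := grow N.
  elim: m => [|m [X [u [eu nl]]]].
    have [Y [v [y [ev nv]]]] := next U _ (essential_id U).
    exists Y, v; split=> // l0; apply: (nv 0); rewrite linear0; exact/esym/l0.
  have [Y [v [y [ev nv]]]] := next X _ eu.
  exists Y, (v \o u : {linear U -> Y}); split; first exact: essential_comp.
  move=> lY; apply: nl; apply: (lenle_add (a := 0) (b := m) (f := resc_map v)) => //.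
    by move=> x [_ vx]; apply: ev.1; rewrite linear0.
  apply: lY => //; first exact: submod_image.
  by exists y; split=> // -[x _ yE]; exact: (nv x).
exists X, u; split=> //.
  have [p [g [_ gX]]] := lenle_fg (lenle_resc (lN _ _ eu)) (conj I (fun _ _ _ _ _ => I)).
  by exists p, g => x; exact: gX.
move=> G sG fG; have [Z [sZ fZ GZ Zmax]] := functional_maximal sG fG.
(* With this sign, v q being the class of (1, 0) says that (1, q) is in Z. *)
have lv : linear (fun x : X => quotproj sZ (0, - x)).
  move=> a x y; rewrite -linearP; congr (quotproj sZ _); congr pair => /=.
    by rewrite scaler0 addr0.
  by rewrite scalerN -opprD.
pose v := mklin lv.
have iv : injective v.
  apply: raddf_inj => x /quotproj_eq0/fZ/eqP.
  by rewrite oppr_eq0 => /eqP.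
have [|q /quot_piP Zq] := umax _ v _ (quotproj sZ (1, 0)).
  split=> // y; have [[a x] <-] := @quotproj_surj _ _ _ sZ y => y0.
  have /Zmax[b [w [Zw wb]]] : ~ Z (a, x) by move=> Zax; apply: y0; exact/quotproj_eq0.
  (* Modulo Z, b (a, x) equals (0, b x - w), which is v (w - b x) and nonzero. *)
  exists b, (w - b *: x); split.
    rewrite -linearZ; apply/quot_piP; have := Zw; congr Z; congr pair => /=.
      by rewrite subr0.
    by rewrite opprK addrC subrK.
  rewrite -(linear0 v) => /iv/eqP; rewrite subr_eq0 => /eqP.
  exact: wb.
exists q => a x /GZ Zax; apply/eqP; rewrite -subr_eq0; apply/eqP/fZ.
have := submodD sZ Zax (submodZ sZ a Zq); congr Z; congr pair => /=.
  by rewrite sub0r [_ *: _]mulrN1 subrr.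
by rewrite subr0 scalerN.
Qed.

End RestrictScalars.

(** * Artin algebras *)

Section ArtinAlgebra.
Variable A : pzRingType.
Hypothesis aA : artin_algebra A.

Lemma artin_algebra_essential_baer (U : lmodType A) : finitely_generated U ->
  exists (X : lmodType A) (u : {linear U -> X}), [/\ essential u, finitely_generated X & baer X].
Proof.
have [k [phi [ak phiC [n [g gA]]]]] := aA.
apply: (essential_baer phiC (artinian_finite_length ak)).
by exists n, g.
Qed.

Lemma artin_algebra_finite_length : finite_length A.
Proof.
have [k [phi [ak phiC [n [g gA]]]]] := aA.
apply: (finite_length_resc (phi := phi) (artinian_finite_length ak)).
by exists n, g.
Qed.

(* The socle of A / jac contains every simple module, so an essential injective
   extension of A / jac is a cogenerator. *)
Lemma artin_algebra_cogenerator : exists I : lmodType A,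
  [/\ finitely_generated I, baer I
    & forall (V : lmodType A) (T : V -> Prop) y, submod T -> ~ T y ->
        exists f : {linear V -> I}, (forall x, T x -> f x = 0) /\ f y <> 0].
Proof.
have fA := artin_algebra_finite_length.
have [I [u [[iu _] fI bI]]] := artin_algebra_essential_baer
  (fg_surj (@quotproj_surj _ _ _ (submod_jac A)) (fg_self A)).
exists I; split=> // V T y sT nTy.
have [|Z [sZ TZ Zy Zmax]] := @submod_maximal A V T (fun x => x = y) sT.
  by move=> x Tx E; apply: nTy; rewrite -E.
have {}Zy : ~ Z y by move=> /Zy; apply.
have mm : maxl (fun a : A => Z (a *: y)).
  apply: maxl_ann => // a /Zmax[b [z [Zz yE]]]; exists b.
  by rewrite -scalerA -{1}yE addrAC subrr add0r.
have [e eP] := socle_generator fA mm.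
(* w has the annihilator of y modulo Z, so a y + z |-> a w is well defined on A y + Z, and w is
   nonzero. *)
pose w : I := u (quotproj (submod_jac A) (e : A^o)).
have wP (a : A) : a *: w = 0 <-> Z (a *: y).
  rewrite -eP /w -!linearZ -(linear0 u); split=> [/iu/quotproj_eq0//|ja].
  by congr (u _); apply/quotproj_eq0.
have [| |f fP] := baer_graph bI (G := fun x : V * I => exists a z, Z z /\ x = (a *: y + z, a *: w)).
- split; first by exists 0, 0; rewrite !scale0r addr0; split=> //; exact: sZ.1.
  move=> a _ _ [b [z [Zz ->]]] [c [t [Zt ->]]].
  exists (a * b + c), (a *: z + t); split; first exact: sZ.2.
  by congr pair; rewrite /= ?scalerDr scalerDl -!scalerA// addrACA.
- move=> x [a [z [Zz [ayz ->]]]]; apply/wP.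
  rewrite -[_ *: y](addrK z) -ayz sub0r; exact: submodN.
exists f; split=> [x Tx|].
  apply/esym/fP; exists 0, x; split; first exact: TZ.
  by rewrite !scale0r add0r.
have <- : 1 *: w = f y.
  by apply: fP; exists 1, 0; rewrite !scale1r addr0; split=> //; exact: sZ.1.
by move=> /wP; rewrite scale1r.
Qed.

Lemma artin_algebra_op : artin_algebra A^c.
Proof.
have [k [phi [ak phiC gen]]] := aA.
pose psi : k -> A^c := phi.
have psiB : zmod_morphism psi by move=> x y; exact: (rmorphB phi).
have psiM : monoid_morphism psi.
  by split=> [|x y]; [exact: (rmorph1 phi)|by rewrite -[LHS]/(phi (x * y)) rmorphM phiC].
pose psia := GRing.isZmodMorphism.Build k A^c psi psiB.
pose psim := GRing.isMonoidMorphism.Build k A^c psi psiM.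
pose psi' : {rmorphism k -> A^c} := HB.pack psi psia psim.
have [n [g gA]] := gen; exists k, psi'; split=> //.
  by move=> c x; exact/esym/phiC.
exists n, g => x; have [c ->] := gA x; exists c.
by apply: eq_bigr => i _; exact: phiC.
Qed.

End ArtinAlgebra.

(** * Vanishing of Ext *)

Section Homological.
Variable R : pzRingType.
Implicit Types K M N P Q : lmodType R.

(** For [short_exact j p] with P projective and p onto M, this is Ext^1(M, N) = 0. *)
Definition extends K P N (j : {linear K -> P}) : Prop :=
  forall f : {linear K -> N}, exists g : {linear P -> N}, forall x, g (j x) = f x.

Definition short_exact K P M (j : {linear K -> P}) (p : {linear P -> M}) : Prop :=
  [/\ injective j, surjective p & exact_at j p].

Definition modker_inc P M (p : {linear P -> M}) : {linear modker p -> P} := val.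

Lemma modker_exact P M (p : {linear P -> M}) : exact_at (modker_inc p) p.
Proof.
move=> x; split=> [px|[z ->]]; last exact/eqP/(valP z).
have xK : x \in modker_pred p by apply/eqP.
by exists (ModKer xK).
Qed.

Lemma short_exact_modker P M (p : {linear P -> M}) :
  surjective p -> short_exact (modker_inc p) p.
Proof. by move=> ps; split=> //; [exact: val_inj|exact: modker_exact]. Qed.

Lemma projective_retract P M (s : {linear M -> P}) (p : {linear P -> M}) :
  (forall x, p (s x) = x) -> projective P -> projective M.
Proof.
move=> ps pP U V q f qs; have [h hE] := pP _ _ q (f \o p) qs.
by exists (h \o s) => x /=; rewrite hE /= ps.
Qed.

Lemma projective_zero M : is_zero M -> projective M.
Proof. by move=> M0 U V q f qs; exists \0 => x; rewrite (M0 x) !linear0. Qed.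

Lemma projective_rV n : projective ('rV[R]_n : lmodType R).
Proof.
move=> U V q f qs.
pose u i := sval (cid (qs (f (delta_mx 0 i)))).
have uE i : q (u i) = f (delta_mx 0 i) by rewrite /u; case: cid.
exists (rv_lift u) => x; rewrite rv_liftE linear_sum rv_linear_sum.
by apply: eq_bigr => i _; rewrite linearZ uE.
Qed.

Lemma projective_section P M (p : {linear P -> M}) : surjective p -> projective M ->
  exists s : {linear M -> P}, forall x, p (s x) = x.
Proof. by move=> ps pM; exact: (pM _ _ p idfun ps). Qed.

Lemma extends_retract K P N Q (j : {linear K -> P}) (s : {linear N -> Q}) (p : {linear Q -> N}) :
  (forall x, p (s x) = x) -> extends Q j -> extends N j.
Proof.
move=> ps eQ f; have [g gE] := eQ (s \o f).
by exists (p \o g) => x /=; rewrite gE /= ps.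
Qed.

Lemma extends_rV K P (j : {linear K -> P}) n :
  extends (R^o : lmodType R) j -> extends ('rV[R]_n : lmodType R) j.
Proof.
move=> eR f; pose c i : {linear 'rV[R]_n -> R^o} := mklin (@rv_coord_linear R n i).
pose g i := sval (cid (eR (c i \o f))).
have gE i x : g i (j x) = f x 0 i by rewrite /g; case: cid => h /= ->.
have lg : linear (fun x => \row_i (g i x : R) : 'rV[R]_n).
  by move=> a x y; apply/rowP => i; rewrite !mxE linearP.
by exists (mklin lg) => x; apply/rowP => i; rewrite mxE gE.
Qed.

Lemma extends_fg_projective K P N (j : {linear K -> P}) :
  extends (R^o : lmodType R) j -> finitely_generated N -> projective N -> extends N j.
Proof.
move=> eR /fg_rv[n [p ps]] pN; have [s sE] := projective_section ps pN.
exact: extends_retract sE (extends_rV eR).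
Qed.

Lemma extends_injective K P N (j : {linear K -> P}) :
  injective j -> injective_module N -> extends N j.
Proof. by move=> ij iN f; exact: iN. Qed.

Lemma extends_ker_projective K P M (j : {linear K -> P}) (p : {linear P -> M}) :
  short_exact j p -> projective P -> extends K j -> projective M.
Proof.
move=> [ij ps jp] pP eK; have [g gE] := eK idfun.
have [|s sE] := factor_surj (h := idfun \- (j \o g)) ps.
  by move=> x /jp[y ->] /=; rewrite gE subrr.
apply: (projective_retract (s := s) (p := p)) => // x; have [y <-] := ps x.
rewrite sE [LHS]linearB /=; have -> : p (j (g y)) = 0 by apply/jp; exists (g y).
by rewrite subr0.
Qed.

(* Syzygies computed from different projective covers are stable retracts of
   each other, so vanishing of Ext does not depend on the resolution. *)
Definition stable_retract M' M : Prop :=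
  exists Q (a : {linear M' -> M}) (b : {linear M -> M'}) (u : {linear M' -> Q})
    (v : {linear Q -> M'}), projective Q /\ forall x, x = b (a x) + v (u x).

Lemma stable_retract_refl M : stable_retract M M.
Proof.
exists (freemod R M), idfun, idfun, \0, \0.
by split=> [|x]; [exact: freemod_projective|rewrite /= addr0].
Qed.

Lemma stable_retract_projective M' M :
  stable_retract M' M -> projective M -> projective M'.
Proof.
move=> [Q [a [b [u [v [pQ abuv]]]]]] pM U V q f qs.
have [h hE] := pM _ _ q (f \o b) qs; have [h' h'E] := pQ _ _ q (f \o v) qs.
exists ((h \o a) \+ (h' \o u)) => x /=; rewrite linearD /= hE h'E /= -linearD.
by rewrite -abuv.
Qed.

Section StableRetract.
Variables (K P M K' P' M' : lmodType R).
Variables (j : {linear K -> P}) (p : {linear P -> M}).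
Variables (j' : {linear K' -> P'}) (p' : {linear P' -> M'}).
Hypotheses (jp : short_exact j p) (jp' : short_exact j' p').
Hypotheses (pP : projective P) (pP' : projective P').

(** Lift a, b and v to the projectives. Since b a + v u = 1 on M', the defect of the lifts maps P'
    into K' and gives the homotopy th; on K' the term through Q vanishes because p' kills K'. *)
Lemma stable_retract_syzygy : stable_retract M' M ->
  exists (a : {linear K' -> K}) (al : {linear P' -> P}) (b : {linear K -> K'})
    (th : {linear P' -> K'}),
    (forall x, j (a x) = al (j' x)) /\ forall x, x = b (a x) + th (j' x).
Proof.
move=> [Q [a [b [u [v [pQ abuv]]]]]].
have [ij ps ejp] := jp; have [ij' ps' ejp'] := jp'.
have [al alE] := pP' (a \o p') ps.
have [be beE] := pP (b \o p) ps'.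
have [ve veE] := pQ _ _ p' v ps'.
have [x|a' a'E] := factor_inj (h := al \o j') ij.
  by apply/ejp; rewrite /= alE /=; have -> : p' (j' x) = 0 by [apply/ejp'; exists x];
    rewrite linear0.
have [x|b' b'E] := factor_inj (h := be \o j) ij'.
  by apply/ejp'; rewrite /= beE /=; have -> : p (j x) = 0 by [apply/ejp; exists x];
    rewrite linear0.
have [x|th thE] := factor_inj (h := idfun \- (be \o al) \- (ve \o (u \o p'))) ij'.
  apply/ejp'; rewrite [LHS]linearB linearB /= beE /= alE veE /=.
  by rewrite {1}(abuv (p' x)) [b _ + _]addrC addrK subrr.
exists a', al, b', th; split=> // x; apply: ij'.
rewrite linearD b'E /= a'E thE /=.
have -> : p' (j' x) = 0 by apply/ejp'; exists x.
by rewrite (linear0 u) (linear0 ve) subr0 addrC subrK.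
Qed.

Lemma stable_retract_ker : stable_retract M' M -> stable_retract K' K.
Proof.
move=> /stable_retract_syzygy[a [al [b [th [_ E]]]]].
by exists P', a, b, j', th.
Qed.

Lemma stable_retract_extends N : stable_retract M' M -> extends N j -> extends N j'.
Proof.
move=> /stable_retract_syzygy[a [al [b [th [aE E]]]]] eN f.
have [g gE] := eN (f \o b); exists ((g \o al) \+ (f \o th)) => x /=.
by rewrite -aE gE /= -linearD -E.
Qed.

End StableRetract.

(** The step Ext^i(-, N'') -> Ext^(i+1)(-, N') -> Ext^(i+1)(-, Q) of the long exact sequence. An
    extension h of i f to P2 induces a map from K1 to N''; extending it over P1 and lifting to Q
    corrects h so that it lands in N'. *)
Lemma extends_shift K2 P2 K1 P1 N' Q N'' (j2 : {linear K2 -> P2})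
    (p2 : {linear P2 -> K1}) (j1 : {linear K1 -> P1})
    (i : {linear N' -> Q}) (q : {linear Q -> N''}) :
  short_exact j2 p2 -> projective P1 -> short_exact i q ->
  extends N'' j1 -> extends Q j2 -> extends N' j2.
Proof.
move=> [ij2 p2s e2] pP1 [ii qs eiq] eN'' eQ f.
have [h hE] := eQ (i \o f).
have [x /e2[y ->]|k kE] := factor_surj (h := q \o h) p2s.
  by rewrite /= hE; apply/eiq; exists (f y).
have [g gE] := eN'' k; have [g' g'E] := pP1 _ _ q g qs.
have [x|t tE] := factor_inj (h := h \- (g' \o (j1 \o p2))) ii.
  by apply/eiq; rewrite [LHS]linearB /= g'E gE kE /= subrr.
exists t => x; apply: ii; rewrite tE /= hE.
have -> : p2 (j2 x) = 0 by apply/e2; exists x.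
by rewrite (linear0 j1) (linear0 g') subr0.
Qed.

(* [ext_vanishes i M N] stands for Ext^(i+1)(M, N) = 0. *)
Definition ext_vanishes i M N : Prop :=
  extends N (modker_inc (freecov (syz M i))).

Lemma short_exact_freecov M : short_exact (modker_inc (freecov M)) (freecov M).
Proof. exact/short_exact_modker/freecov_surj. Qed.

Lemma homology_zero (U V W : zmodType) (f : {additive U -> V}) (g : {additive V -> W}) :
  is_zero (homology f g) <-> forall v, g v = 0 -> exists u, v = f u.
Proof.
split=> [h0 v gv|h q].
  have vK : v \in zker_pred g by apply/eqP.
  have /eqP : (\pi_(homology f g) (ZKer vK) = \pi_(homology f g) 0)%qT.
    by rewrite (h0 (\pi_(homology f g) _)%qT) (h0 (\pi_(homology f g) 0)%qT).
  by rewrite -Quotient.idealrBE subr0 => /asboolP.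
rewrite -[q]reprK -[RHS]reprK; apply/eqP; rewrite -Quotient.idealrBE.
by apply/asboolP/h/eqP; exact: (valP (repr q - repr 0)).
Qed.

Lemma Hom_eq M N (f g : Defs.Hom M N) : f = g ->
  forall x, (f : {linear M -> N}) x = (g : {linear M -> N}) x.
Proof. by move=> ->. Qed.

(** A cocycle is a map on [syz M i.+1] composed with its free cover, and it is a coboundary when
    that map extends to the cover of [syz M i]. *)
Lemma Ext_zero i M N : is_zero (Ext i.+1 M N) <-> ext_vanishes i M N.
Proof.
have [inj1 s1 ex1] := short_exact_freecov (syz M i.+1).
rewrite /Ext /=; split=> [/homology_zero h f|h].
  have [|g gE] := h (f \o freecov (syz M i.+1) : {linear _ -> _}).
    apply: HomP => x; rewrite /= /pullback /=.
    have -> : freecov (syz M i.+1) (free_d M i.+1 x) = 0; last by rewrite linear0.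
    by apply: (proj2 (@free_d_exact R M i.+1 _)); exists x.
  exists (g : {linear _ -> _}) => x; have [y <-] := s1 x.
  have := Hom_eq gE y.
  by rewrite /= /pullback /= => <-.
apply/homology_zero => v vd.
have [x /(proj1 (@free_d_exact R M i.+1 _))[y ->]|f fE] := factor_surj (h := v : {linear _ -> _}) s1.
  by have := Hom_eq vd y.
have [g gE] := h f; exists g; apply: HomP => x.
by rewrite /= /pullback /= gE fE.
Qed.

End Homological.

(** * Syzygies and finitistic dimension *)

Section Syzygies.
Variable R : pzRingType.
Implicit Types K M N P Q : lmodType R.

(** The last two clauses are implications so that every M has such a cover and the choice is a total
    function of M. *)
Definition good_cover M P (p : {linear P -> M}) : Prop :=
  [/\ surjective p, projective P, finitely_generated M -> finitely_generated P
    & projective M -> injective p].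

Lemma good_cover_exists M : exists P (p : {linear P -> M}), good_cover p.
Proof.
have [pM|npM] := pselect (projective M).
  exists M, idfun; split=> //; first by move=> x; exists x.
  by move=> _ x y.
have [/fg_rv[n [p ps]]|nfM] := pselect (finitely_generated M).
  exists 'rV[R]_n, p; split=> //; first exact: projective_rV.
  by move=> _; exact: fg_rV.
exists (freemod R M), (freecov M); split=> //; first exact: freecov_surj.
exact: freemod_projective.
Qed.

Definition cover_obj M : lmodType R := sval (cid (good_cover_exists M)).

Definition cover_map M : {linear cover_obj M -> M} :=
  sval (cid (svalP (cid (good_cover_exists M)))).

Lemma cover_mapP M : good_cover (cover_map M).
Proof. exact: (svalP (cid (svalP (cid (good_cover_exists M))))). Qed.

(* Syzygies for the covers [cover_map], which unlike those of [syz] are finitely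
   generated over a noetherian ring and stop at projective modules. *)
Fixpoint csyz M (i : nat) : lmodType R :=
  match i with 0 => M | j.+1 => modker (cover_map (csyz M j)) end.

Lemma short_exact_cover M : short_exact (modker_inc (cover_map M)) (cover_map M).
Proof. by apply: short_exact_modker; case: (cover_mapP M). Qed.

Lemma cover_projective M : projective (cover_obj M).
Proof. by case: (cover_mapP M). Qed.

Lemma csyz_stable_retract M i :
  stable_retract (csyz M i) (syz M i) /\ stable_retract (syz M i) (csyz M i).
Proof.
elim: i => [|i [IH1 IH2]]; first by split; exact: stable_retract_refl.
have [pc pf] := (@cover_projective (csyz M i), @freemod_projective R (syz M i)).
have [ec ef] := (short_exact_cover (csyz M i), short_exact_freecov (syz M i)).
by split; [exact: stable_retract_ker ef ec pf pc IH1|exact: stable_retract_ker ec ef pc pf IH2].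
Qed.

Lemma ext_vanishes_csyz i M N : ext_vanishes i M N ->
  extends N (modker_inc (cover_map (csyz M i))).
Proof.
apply: (stable_retract_extends (short_exact_freecov _) (short_exact_cover _)).
- exact: freemod_projective.
- exact: cover_projective.
- exact: (csyz_stable_retract M i).1.
Qed.

(** The identity of the next syzygy extends to the cover, so the syzygy sequence splits. *)
Lemma csyz_projective_prev i M :
  ext_vanishes i M (csyz M i.+1) -> projective (csyz M i).
Proof.
move=> /ext_vanishes_csyz; apply: extends_ker_projective (short_exact_cover _) _.
exact: cover_projective.
Qed.

Lemma csyz_projective_next i M : projective (csyz M i) -> is_zero (csyz M i.+1).
Proof.
move=> pM z; apply: val_inj; have [_ _ _ /(_ pM)ci] := cover_mapP (csyz M i).
apply: ci; rewrite linear0; exact/eqP/(valP z).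
Qed.

Lemma csyz_projective_leq i j M : (i <= j)%N ->
  projective (csyz M i) -> projective (csyz M j).
Proof.
move=> /subnK <-; elim: (j - i)%N => // m IH /IH/csyz_projective_next.
exact: projective_zero.
Qed.

Lemma csyz_fg i M : finite_length R -> finitely_generated M ->
  finitely_generated (csyz M i).
Proof.
move=> fR fM; elim: i => [//|i IH].
have [_ _ /(_ IH) fc _] := cover_mapP (csyz M i).
exact: finite_length_fg_inj fR _ _ (modker_inc _) val_inj fc.
Qed.

Lemma cover_fg M : finitely_generated M -> finitely_generated (cover_obj M).
Proof. by case: (cover_mapP M). Qed.

Lemma csyz_proj_dim_le n M : projective (csyz M n) -> proj_dim_le M n.
Proof.
move=> pn; pose d i : {linear cover_obj (csyz M i.+1) -> cover_obj (csyz M i)} :=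
  modker_inc (cover_map (csyz M i)) \o cover_map (csyz M i.+1).
have dE i : exact_at (d i) (cover_map (csyz M i)).
  have [s _ _ _] := cover_mapP (csyz M i.+1).
  move=> x; split=> [/modker_exact[z ->]|[z ->]]; last by apply/modker_exact; exists (cover_map _ z).
  by have [y <-] := s z; exists y.
have ds : surjective (cover_map M) by case: (cover_mapP M).
have dES i : exact_at (d i.+1) (d i).
  move=> x; rewrite -dE /d /=; split=> [x0|-> //]; exact/val_inj.
exists (@ProjectiveResolution R M (fun i => cover_obj (csyz M i)) d (cover_map M)
  (fun i => @cover_projective (csyz M i)) ds (dE 0%N) dES) => -[//|i] /= ni x.
have z0 := csyz_projective_next (@csyz_projective_leq n i M ni pn).
have [_ _ _ ci] := cover_mapP (csyz M i.+1).
apply: (ci (projective_zero z0)); rewrite linear0; exact: z0.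
Qed.

Fixpoint pdle (n : nat) M : Prop :=
  match n with
  | 0 => projective M
  | m.+1 => exists K P (j : {linear K -> P}) (p : {linear P -> M}),
      [/\ short_exact j p, projective P & pdle m K]
  end.

Lemma proj_dim_le_pdle n M : proj_dim_le M n -> pdle n M.
Proof.
elim: n M => [|n IH] M [P P0] /=.
  have ia : injective (pres_aug P).
    by apply: raddf_inj => x /pres_exact0[y ->]; rewrite (P0 1%N _ y) ?linear0.
  have [|s sE] := factor_surj (h := idfun : {linear P 0%N -> P 0%N}) (@pres_aug_surj _ _ P).
    by move=> x; rewrite -(linear0 (pres_aug P)) => /ia.
  apply: (projective_retract (s := s) (p := pres_aug P)); last exact: pres_projective.
  by move=> x; have [y <-] := pres_aug_surj P x; rewrite sE.
exists (modker (pres_aug P)), (P 0%N), (modker_inc _), (pres_aug P).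
have se : short_exact (modker_inc (pres_aug P)) (pres_aug P).
  exact/short_exact_modker/pres_aug_surj.
split=> //; first exact: pres_projective.
have [inc _ ex] := se.
have [x|a aE] := factor_inj (h := pres_d P 0) inc.
  by apply/ex/pres_exact0; exists x.
have asurj : surjective a.
  move=> z; have /pres_exact0[x xE] : pres_aug P (modker_inc _ z) = 0 by apply/ex; exists z.
  by exists x; apply: inc; rewrite aE.
have aex : exact_at (pres_d P 1) a.
  move=> x; rewrite -(@pres_exactS _ _ P 0 x) -aE; split=> [->|]; first by rewrite linear0.
  by rewrite -(linear0 (modker_inc (pres_aug P))) => /inc.
apply: IH; exists (@ProjectiveResolution R _ (fun i => P i.+1) (fun i => pres_d P i.+1) a
  (fun i => @pres_projective _ _ P i.+1) asurj aex (fun i => @pres_exactS _ _ P i.+1)).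
by move=> i ni; apply: P0.
Qed.

(** Schanuel's lemma along the resolution: generalising over n and K lets the induction compare an
    arbitrary resolution with [csyz]. *)
Lemma pdle_csyz n m M K : stable_retract (csyz M n) K -> pdle m K ->
  projective (csyz M (n + m)).
Proof.
elim: m n K => [|m IH] n K sr /=; first by rewrite addn0; exact: stable_retract_projective.
move=> [K' [P [j [p [jp pP pK']]]]]; rewrite addnS -addSn; apply: IH pK'.
by apply: (stable_retract_ker jp (short_exact_cover _)) sr => //; exact: cover_projective.
Qed.

Fixpoint idle (n : nat) N : Prop :=
  match n with
  | 0 => injective_module N
  | m.+1 => exists Q N' (i : {linear N -> Q}) (q : {linear Q -> N'}),
      [/\ short_exact i q, injective_module Q & idle m N']
  end.

Lemma inj_dim_le_idle n N : inj_dim_le N n -> idle n N.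
Proof.
elim: n N => [|n IH] N [I I0] /=.
  have [x|s sE] := factor_inj (h := idfun : {linear I 0%N -> I 0%N}) (@ires_aug_inj _ _ I).
    by apply/ires_exact0; exact: (I0 1%N).
  move=> U V j f ij; have [h hE] := @ires_injective _ _ I 0 _ _ _ (ires_aug I \o f) ij.
  by exists (s \o h) => x /=; apply: (@ires_aug_inj _ _ I); rewrite sE hE.
have inc : injective (modker_inc (ires_d I 1)) by exact: val_inj.
have ex := @modker_exact _ _ _ (ires_d I 1).
have [x|q qE] := factor_inj (h := ires_d I 0) inc.
  by apply/ex/ires_exactS; exists x.
exists (I 0%N), (modker (ires_d I 1)), (ires_aug I), q; split.
- split; first exact: ires_aug_inj.
    move=> z; have /ires_exactS[x xE] : ires_d I 1 (modker_inc _ z) = 0 by apply/ex; exists z.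
    by exists x; apply: inc; rewrite qE.
  move=> x; rewrite -(@ires_exact0 _ _ I x) -qE; split=> [->|]; first by rewrite linear0.
  by rewrite -(linear0 (modker_inc (ires_d I 1))) => /inc.
- exact: ires_injective.
have ex' : exact_at (modker_inc (ires_d I 1)) (ires_d I 1) by [].
apply: IH; exists (@InjectiveResolution R _ (fun i => I i.+1) (fun i => ires_d I i.+1)
  (modker_inc (ires_d I 1)) (fun i => @ires_injective _ _ I i.+1) inc ex'
  (fun i => @ires_exactS _ _ I i.+1)).
by move=> i ni; apply: I0.
Qed.

Lemma ext_vanishes_injective i M N : injective_module N -> ext_vanishes i M N.
Proof. by move=> iN; apply: extends_injective => //; exact: val_inj. Qed.

Lemma ext_vanishes_shift i M N Q N' (j : {linear N -> Q}) (q : {linear Q -> N'}) :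
  short_exact j q -> ext_vanishes i M N' -> ext_vanishes i.+1 M Q ->
  ext_vanishes i.+1 M N.
Proof.
move=> jq; apply: (extends_shift (short_exact_freecov (syz M i.+1)) _ jq).
exact: freemod_projective.
Qed.

Lemma idle_ext_vanishes n N : idle n N -> forall i M, (n <= i)%N -> ext_vanishes i M N.
Proof.
elim: n N => [|n IH] N /=; first by move=> iN i M _; exact: ext_vanishes_injective.
move=> [Q [N' [j [q [jq iQ dN']]]]] [//|i] M ni.
by apply: (ext_vanishes_shift jq); [exact: IH|exact: ext_vanishes_injective].
Qed.

Section FiniteInjectiveDimension.
Hypothesis fR : finite_length R.
Variables (n : nat) (nP : idle n (R^o : lmodType R)).

Lemma ext_vanishes_fg_projective i M N : (n <= i)%N ->
  finitely_generated N -> projective N -> ext_vanishes i M N.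
Proof.
move=> ni fN pN; apply: (extends_fg_projective _ fN pN).
exact: (idle_ext_vanishes nP ni).
Qed.

(** Descend from the projective dimension m to n: while i >= n, a projective syzygy i + 1 makes
    Ext^(i+1)(M, -) vanish on it, so the syzygy i is projective too. *)
Lemma finite_findim_of_idle : finite_findim R.
Proof.
exists n => M fM [m /proj_dim_le_pdle/(@pdle_csyz 0 m M)].
rewrite add0n => /(_ (stable_retract_refl M)) pm; apply: csyz_proj_dim_le.
have [mn|/ltnW nm] := leqP m n; first exact: csyz_projective_leq pm.
move: pm; rewrite -(subnK nm); elim: (m - n)%N => [//|i IH pi]; apply: IH.
apply: csyz_projective_prev; apply: ext_vanishes_fg_projective pi.
  exact: leq_addl.
exact: csyz_fg.
Qed.

Lemma ext_vanishes_csyz_injective M i : finitely_generated M -> injective_module M ->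
  exists m, forall t, (m <= t)%N -> ext_vanishes t M (csyz M i).
Proof.
move=> fM iM; elim: i => [|i [m mP]].
  by exists 0%N => t _; exact: ext_vanishes_injective.
(* One degree is lost in the shift, and n makes Ext vanish on the projective cover. *)
exists (maxn m n).+1 => -[//|t]; rewrite ltnS geq_max => /andP[mt nt].
apply: (ext_vanishes_shift (short_exact_cover _)); first exact: mP.
apply: ext_vanishes_fg_projective; [exact: leqW|exact/cover_fg/csyz_fg|].
exact: cover_projective.
Qed.

Lemma AC_csyz_projective M : satisfies_AC R ->
  finitely_generated M -> injective_module M -> exists b, projective (csyz M b).
Proof.
move=> AC fM iM; have [b bP] := AC M fM; exists b.
(* The degree asked for is b + 1, the first one that (AC) covers. *)
apply: csyz_projective_prev; apply/Ext_zero; apply: bP => //; first exact: csyz_fg.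
have [m mP] := ext_vanishes_csyz_injective b.+1 fM iM.
by exists m => -[//|i] mi; apply/Ext_zero/mP.
Qed.

End FiniteInjectiveDimension.

End Syzygies.

(** * Cosyzygies *)

Section Cosyzygies.
Variable R : pzRingType.
Hypothesis hullR : forall U : lmodType R, finitely_generated U ->
  exists (X : lmodType R) (u : {linear U -> X}),
    [/\ essential u, finitely_generated X & baer X].
Implicit Types N X : lmodType R.

(** Total in N by the same device as [good_cover]; the surjectivity clause makes the cosyzygies
    vanish after an injective one. *)
Definition good_hull N X (u : {linear N -> X}) : Prop :=
  (finitely_generated N -> [/\ injective u, finitely_generated X & baer X]) /\
  (baer N -> surjective u).

Lemma good_hull_exists N : exists X (u : {linear N -> X}), good_hull u.
Proof.
have [bN|nbN] := pselect (baer N).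
  by exists N, idfun; split=> [fN|_ x]; [split=> // x y|exists x].
have [/hullR[X [u [[iu _] fX bX]]]|nfN] := pselect (finitely_generated N).
  by exists X, u.
by exists N, idfun.
Qed.

Definition hull_obj N : lmodType R := sval (cid (good_hull_exists N)).

Definition hull_map N : {linear N -> hull_obj N} :=
  sval (cid (svalP (cid (good_hull_exists N)))).

Lemma hull_mapP N : good_hull (hull_map N).
Proof. exact: (svalP (cid (svalP (cid (good_hull_exists N))))). Qed.

Lemma submod_hull N : submod (fun y => exists2 x, True & y = hull_map N x).
Proof. exact: (@submod_image _ _ _ (hull_map N) (fun=> True)). Qed.

Fixpoint cosyz N (i : nat) : lmodType R :=
  match i with 0 => N | j.+1 => quotmod (submod_hull (cosyz N j)) end.

Definition cosyz_proj N i : {linear hull_obj (cosyz N i) -> cosyz N i.+1} :=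
  quotproj (submod_hull (cosyz N i)).

Lemma cosyz_fg N i : finitely_generated N -> finitely_generated (cosyz N i).
Proof.
move=> fN; elim: i => [//|i /(hull_mapP (cosyz N i)).1[_ fX _]].
exact: fg_surj (@quotproj_surj _ _ _ _) fX.
Qed.

Lemma cosyz_short_exact N i : finitely_generated N ->
  short_exact (hull_map (cosyz N i)) (cosyz_proj N i).
Proof.
move=> /(cosyz_fg i)/(hull_mapP (cosyz N i)).1[iu _ _]; split=> //.
  exact: quotproj_surj.
by move=> x; split=> [/quotproj_eq0[y _ ->]|[y ->]]; [exists y|apply/quotproj_eq0; exists y].
Qed.

Lemma baer_zero N : is_zero N -> baer N.
Proof. by move=> N0 G _ _; exists 0 => a x _; rewrite (N0 x) (N0 (a *: 0)). Qed.

Lemma cosyz_baer_zero N t i : baer (cosyz N t) -> (t < i)%N -> is_zero (cosyz N i).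
Proof.
move=> bt; elim: i => [//|i IH]; rewrite ltnS leq_eqVlt => ti x.
have bi : baer (cosyz N i).
  by move: ti => /orP[/eqP<-//|/IH]; exact: baer_zero.
have [y <-] := @quotproj_surj _ _ _ _ x; apply/quotproj_eq0.
by have [z <-] := (hull_mapP (cosyz N i)).2 bi y; exists z.
Qed.

Lemma cosyz_inj_dim_le N t : finitely_generated N -> baer (cosyz N t) -> inj_dim_le N t.
Proof.
move=> fN bt; have se i := cosyz_short_exact i fN.
pose d i : {linear hull_obj (cosyz N i) -> hull_obj (cosyz N i.+1)} :=
  hull_map (cosyz N i.+1) \o cosyz_proj N i.
have inj i : injective_module (hull_obj (cosyz N i)).
  by have [_ _ /baer_injective] := (hull_mapP (cosyz N i)).1 (cosyz_fg i fN).
have ai : injective (hull_map N) by case: (se 0%N).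
have dE i x : d i x = 0 <-> cosyz_proj N i x = 0.
  have [iu _ _] := se i.+1; rewrite /d /=; split=> [|->]; last by rewrite linear0.
  by rewrite -(linear0 (hull_map (cosyz N i.+1))) => /iu.
have ex0 : exact_at (hull_map N) (d 0%N).
  by move=> x; rewrite dE; have [_ _] := se 0%N; apply.
have exS i : exact_at (d i) (d i.+1).
  move=> x; rewrite dE; have [_ _ ->] := se i.+1; have [_ s _] := se i.
  split=> [[y ->]|[y ->]]; last by exists (cosyz_proj N i y).
  by have [z <-] := s y; exists z.
exists (@InjectiveResolution R N _ d (hull_map N) inj ai ex0 exS) => i ti /= x.
have z0 := cosyz_baer_zero bt ti.
by have [y <-] := (hull_mapP (cosyz N i)).2 (baer_zero z0) x; rewrite (z0 y) linear0.
Qed.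

End Cosyzygies.

(** * Complexes of finitely generated free modules *)

Section MatrixComplexes.
Variable A : pzRingType.

(** D on columns over A is a map of free right modules; [lact] is this map tensored with V, and
    [ract] is Hom of it into N. *)
Definition lact (V : lmodType A) m n (D : 'M[A]_(m, n)) (v : 'I_n -> V) : 'I_m -> V :=
  fun p => \sum_q D p q *: v q.

Definition ract (N : lmodType A^c) m n (y : 'I_m -> N) (D : 'M[A]_(m, n)) : 'I_n -> N :=
  fun q => \sum_p (D p q : A^c) *: y p.

Lemma lactM (V : lmodType A) m n r (D : 'M[A]_(m, n)) (D' : 'M[A]_(n, r)) (v : 'I_r -> V) :
  lact (D *m D') v = lact D (lact D' v).
Proof.
apply/funext => p; rewrite /lact; under eq_bigr do rewrite mxE scaler_suml.
rewrite exchange_big; apply: eq_bigr => q _; rewrite scaler_sumr.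
by apply: eq_bigr => s _; rewrite scalerA.
Qed.

Lemma ractM (N : lmodType A^c) m n r (y : 'I_m -> N) (D : 'M[A]_(m, n)) (D' : 'M[A]_(n, r)) :
  ract y (D *m D') = ract (ract y D) D'.
Proof.
apply/funext => p; rewrite /ract; under eq_bigr do rewrite mxE.
under eq_bigr => q _.
  have -> : (\sum_(j < n) D q j * D' j p : A^c) *: y q
      = \sum_(j < n) (D q j * D' j p : A^c) *: y q by rewrite -scaler_suml.
  over.
rewrite exchange_big; apply: eq_bigr => q _; rewrite scaler_sumr.
by apply: eq_bigr => s _; rewrite scalerA.
Qed.

Lemma lact_map (V W : lmodType A) (f : {linear V -> W}) m n (D : 'M[A]_(m, n)) v :
  lact D (f \o v) = f \o lact D v.
Proof.
by apply/funext => p; rewrite /= linear_sum; apply: eq_bigr => q _; rewrite linearZ.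
Qed.

Lemma ract_map (V W : lmodType A^c) (f : {linear V -> W}) m n (D : 'M[A]_(m, n)) v :
  ract (f \o v) D = f \o ract v D.
Proof.
by apply/funext => p; rewrite /= linear_sum; apply: eq_bigr => q _; rewrite linearZ.
Qed.

Lemma lactB (V : lmodType A) m n (D : 'M[A]_(m, n)) (v w : 'I_n -> V) :
  lact D (fun q => v q - w q) = fun p => lact D v p - lact D w p.
Proof.
by apply/funext => p; rewrite /lact -sumrB; apply: eq_bigr => q _; rewrite scalerBr.
Qed.

Lemma ractB (N : lmodType A^c) m n (D : 'M[A]_(m, n)) (v w : 'I_m -> N) :
  ract (fun q => v q - w q) D = fun p => ract v D p - ract w D p.
Proof.
by apply/funext => p; rewrite /ract -sumrB; apply: eq_bigr => q _; rewrite scalerBr.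
Qed.

Definition exact_on (V : lmodType A) m n r (D : 'M[A]_(m, n)) (D' : 'M[A]_(n, r)) : Prop :=
  forall v : 'I_n -> V, lact D v = (fun=> 0) -> exists w, v = lact D' w.

Definition col_exact m n r (D : 'M[A]_(m, n)) (D' : 'M[A]_(n, r)) : Prop :=
  D *m D' = 0 /\ exact_on (A^o : lmodType A) D D'.

Lemma lact0 (V : lmodType A) m n (v : 'I_n -> V) : lact (0 : 'M[A]_(m, n)) v = fun=> 0.
Proof. by apply/funext => p; rewrite /lact big1// => q _; rewrite mxE scale0r. Qed.

Lemma ract0 (N : lmodType A^c) m n (v : 'I_m -> N) : ract v (0 : 'M[A]_(m, n)) = fun=> 0.
Proof. by apply/funext => p; rewrite /ract big1// => q _; rewrite mxE scale0r. Qed.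

(** V is a direct summand of a free module of finite rank, where the system is solved one coordinate
    at a time. *)
Lemma exact_on_fg_projective (V : lmodType A) m n r (D : 'M[A]_(m, n)) (D' : 'M[A]_(n, r)) :
  col_exact D D' -> finitely_generated V -> projective V -> exact_on V D D'.
Proof.
move=> [_ ex] /fg_rv[c [p ps]] pV v Dv; have [s sE] := projective_section ps pV.
have colP t : exists w : 'I_r -> A^o, (fun q => s (v q) 0 t) = lact D' w.
  apply: ex; apply/funext => i.
  have /(congr1 (fun f => s (f i) 0 t)) := Dv.
  rewrite linear0 mxE => <-; rewrite /lact linear_sum summxE.
  by apply: eq_bigr => q _; rewrite linearZ mxE.
pose w t := sval (cid (colP t)).
have wE t : (fun q => s (v q) 0 t) = lact D' (w t) by rewrite /w; case: cid.
exists (p \o (fun q => \row_t (w t q : A))); rewrite lact_map.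
apply/funext => q /=; rewrite -[LHS]sE; congr (p _); apply/rowP => t.
have := congr1 (fun f => f q) (wE t) => /= ->; rewrite /lact summxE.
by apply: eq_bigr => i _; rewrite !mxE.
Qed.

(** Long exact sequence: the homology of V at D', D'' lies between that of P there and that of K one
    place lower. *)
Lemma exact_on_shift (K P V : lmodType A) (j : {linear K -> P}) (p : {linear P -> V})
    m n r s (D : 'M[A]_(m, n)) (D' : 'M[A]_(n, r)) (D'' : 'M[A]_(r, s)) :
  short_exact j p -> D *m D' = 0 -> exact_on K D D' -> exact_on P D' D'' ->
  exact_on V D' D''.
Proof.
move=> [ij ps jp] DD' exK exP v D'v.
pose q i := sval (cid (ps (v i))).
have qE : p \o q = v by apply/funext => i; rewrite /q /=; case: cid.
have kP i : exists k, lact D' q i = j k.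
  apply/jp; have := congr1 (fun f => f i) (lact_map p D' q).
  by rewrite qE D'v => /= ->.
pose k i := sval (cid (kP i)).
have kE : j \o k = lact D' q by apply/funext => i; rewrite /k /=; case: cid.
have [w kw] : exists w, k = lact D' w.
  apply: exK; apply/funext => i; apply: ij; rewrite linear0.
  have := congr1 (fun f => f i) (lact_map j D k) => /= <-.
  by rewrite kE -lactM DD' lact0.
have [u qu] : exists u, (fun i => q i - j (w i)) = lact D'' u.
  apply: exP; rewrite lactB; apply/funext => i.
  by rewrite (lact_map j D' w) -kw -kE subrr.
exists (p \o u); rewrite lact_map -qu -qE; apply/funext => i /=.
by rewrite linearB; have -> : p (j (w i)) = 0 by [apply/jp; exists (w i)]; rewrite subr0.
Qed.

End MatrixComplexes.

(** * Tensor and Hom complexes of an exact sequence of matrices *)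

Section Complex.
Variable A : pzRingType.
Variables (n : nat -> nat) (D : forall i, 'M[A]_(n i, n i.+1)).
Hypothesis Dex : forall i, col_exact (D i) (D i.+1).

(** Exactness holds at every place for the projective Omega^t I, and each step back from a syzygy to
    the module it resolves loses one place. *)
Lemma exact_on_csyz (I : lmodType A) t i : finite_length A -> finitely_generated I ->
  projective (csyz I t) -> (t <= i)%N -> exact_on I (D i) (D i.+1).
Proof.
move=> fA fI pI ti.
suff key s : (s <= t)%N -> forall j, (s <= j)%N -> exact_on (csyz I (t - s)) (D j) (D j.+1).
  by have := key t (leqnn t) i ti; rewrite subnn.
elim: s {i ti} => [|s IH] st i si.
  by rewrite subn0; exact: exact_on_fg_projective (Dex i) (csyz_fg _ fA fI) pI.
case: i si => [//|i] si.
apply: (exact_on_shift (short_exact_cover _) (Dex i).1).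
  by rewrite -[modker _]/(csyz I (t - s.+1).+1) subnSK//; apply: IH => //; exact: ltnW.
apply: exact_on_fg_projective (Dex _) (cover_fg (csyz_fg _ fA fI)) _.
exact: cover_projective.
Qed.

Definition row_exact_on (N : lmodType A^c) i : Prop :=
  forall y : 'I_(n i.+1) -> N, ract y (D i.+1) = (fun=> 0) ->
  exists z, y = ract z (D i).

(* If y is not in the image of D_i, some f into the cogenerator I kills that
   image but not y; f is a vector v in I^n with D_i v = 0, so v = D_(i+1) w and
   f y = (y D_(i+1)) w = 0. *)
Lemma row_exact_on_self (I : lmodType A) i :
  (forall (V : lmodType A) (T : V -> Prop) y, submod T -> ~ T y ->
     exists f : {linear V -> I}, (forall x, T x -> f x = 0) /\ f y <> 0) ->
  exact_on I (D i) (D i.+1) -> row_exact_on (A^c^o : lmodType A^c) i.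
Proof.
move=> cogen exI y yD; pose r : 'rV[A]_(n i.+1) := \row_q (y q : A).
pose T (x : 'rV[A]_(n i.+1)) := exists z, x = z *m D i.
have sT : submod T.
  split; first by exists 0; rewrite mul0mx.
  move=> a _ _ [u ->] [v ->]; exists (a *: u + v).
  by rewrite mulmxDl scalemxAl.
have [[z rz]|nT] := pselect (T r).
  exists (fun p => z 0 p : A^c^o); apply/funext => q.
  by have := congr1 (fun x : 'rV[A]_(n i.+1) => x 0 q) rz; rewrite !mxE.
have [f [fT fr]] := cogen _ T r sT nT.
pose v q := f (delta_mx 0 q).
have [w vw] : exists w, v = lact (D i.+1) w.
  apply: exI; apply/funext => p; rewrite /lact /v.
  rewrite -[RHS](fT (row p (D i))); last by exists (delta_mx 0 p); rewrite rowE.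
  by rewrite [RHS]rv_linear_sum; apply: eq_bigr => q _; rewrite mxE.
case: fr; rewrite rv_linear_sum.
transitivity (\sum_q (y q : A) *: v q); first by apply: eq_bigr => q _; rewrite mxE.
rewrite vw /lact; under eq_bigr do rewrite scaler_sumr.
rewrite exchange_big big1//= => s _.
under eq_bigr do rewrite scalerA.
rewrite -scaler_suml.
have := congr1 (fun f => f s) yD; rewrite /ract => e.
by rewrite [X in X *: _]e scale0r.
Qed.

(** The value at the column w of the map of right modules from A^m to N given by y. *)
Definition pairing (N : lmodType A^c) m (y : 'I_m -> N) (w : 'I_m -> A) : N :=
  \sum_q (w q : A^c) *: y q.

Lemma pairing_lact (N : lmodType A^c) m r (y : 'I_m -> N) (E : 'M[A]_(m, r)) (w : 'I_r -> A) :
  pairing y (lact E (w : 'I_r -> A^o)) = pairing (ract y E) w.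
Proof.
rewrite /pairing /lact /ract.
transitivity (\sum_q \sum_p (E q p * w p : A^c) *: y q).
  by apply: eq_bigr => q _; rewrite -scaler_suml.
rewrite exchange_big; apply: eq_bigr => p _; rewrite scaler_sumr.
by apply: eq_bigr => q _; rewrite scalerA.
Qed.

(** y kills the image of D_(i+1), which is the kernel of D_i, so D_i w |-> y w is a well-defined map
    on the image of D_i; an extension of it to the free module gives z. *)
Lemma row_exact_on_baer (Q : lmodType A^c) i : baer Q -> row_exact_on Q i.
Proof.
move=> bQ y yD.
pose G (x : 'rV[A^c]_(n i) * Q) := exists w : 'I_(n i.+1) -> A^o,
  (forall p, x.1 0 p = lact (D i) w p) /\ x.2 = pairing y w.
have [| |g gG] := baer_graph bQ (G := G).
- split.
    exists (fun=> 0); split=> [p|]; first by rewrite mxE /lact big1// => q _; rewrite scaler0.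
    by rewrite /pairing big1// => q _; rewrite scale0r.
  move=> a [x s] [x' s'] [w /= [xw ->]] [w' /= [xw' ->]].
  exists (fun q => (w q : A) * a + w' q); split=> [p|] /=.
    rewrite !mxE xw xw' /lact -[a * _]/((_ : A) * (a : A)) mulr_suml -big_split.
    by apply: eq_bigr => q _; rewrite [RHS]mulrDr mulrA.
  rewrite /pairing scaler_sumr -big_split; apply: eq_bigr => q _.
  by rewrite scalerA [RHS]scalerDl.
- move=> s [w /= [w0 ->]].
  have [|u ->] := (Dex i).2 w; first by apply/funext => p; rewrite -w0 mxE.
  by rewrite pairing_lact yD /pairing big1// => q _; rewrite scaler0.
exists (fun p => g (delta_mx 0 p)); apply/funext => q; apply/esym.
pose e : 'I_(n i.+1) -> A^o := fun q' => (q' == q)%:R.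
have yq : y q = g (\row_p (D i p q : A^c)).
  apply: gG; exists e; split=> [p|] /=.
    rewrite mxE /lact (bigD1 q)//= /e eqxx big1 ?addr0 => [|q' /negPf->].
      by rewrite [RHS]mulr1.
    by rewrite scaler0.
  rewrite /pairing (bigD1 q)//= /e eqxx scale1r big1 ?addr0// => q' /negPf->.
  by rewrite scale0r.
by rewrite yq rv_linear_sum; apply: eq_bigr => p _; rewrite mxE.
Qed.

(** The cohomology of N' at i lies between that of Q at i and that of N at i + 1. *)
Lemma row_exact_on_shift (N Q N' : lmodType A^c) (j : {linear N -> Q}) (p : {linear Q -> N'}) i :
  short_exact j p -> row_exact_on N i.+1 -> row_exact_on Q i -> row_exact_on N' i.
Proof.
move=> [ij ps jp] exN exQ y yD.
pose q k := sval (cid (ps (y k))).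
have qE : p \o q = y by apply/funext => k; rewrite /q /=; case: cid.
have kP s : exists k, ract q (D i.+1) s = j k.
  apply/jp; have := congr1 (fun f => f s) (ract_map p (D i.+1) q).
  by rewrite qE yD => /= ->.
pose k s := sval (cid (kP s)).
have kE : j \o k = ract q (D i.+1) by apply/funext => s; rewrite /k /=; case: cid.
have [w kw] : exists w, k = ract w (D i.+1).
  apply: exN; apply/funext => s; apply: ij; rewrite linear0.
  have := congr1 (fun f => f s) (ract_map j (D i.+2) k) => /= <-.
  by rewrite kE -ractM (Dex i.+1).1 ract0.
have [u qu] : exists u, (fun s => q s - j (w s)) = ract u (D i).
  apply: exQ; rewrite ractB; apply/funext => s.
  by rewrite (ract_map j (D i.+1) w) -kw -kE subrr.
exists (p \o u); rewrite ract_map -qu -qE; apply/funext => s /=.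
by rewrite linearB; have -> : p (j (w s)) = 0 by [apply/jp; exists (w s)]; rewrite subr0.
Qed.

End Complex.

(** * Baer's criterion through matrix resolutions *)

Section RightIdeals.
Variable A : pzRingType.
Hypothesis fAc : finite_length A^c.

Lemma col_kernel_exists m n (D : 'M[A]_(m, n)) :
  exists r (D' : 'M[A]_(n, r)), col_exact D D'.
Proof.
pose S (x : 'rV[A^c]_n) := forall p, lact D (x 0 : 'I_n -> A^o) p = 0.
have sS : submod S.
  split=> [p|a x y Sx Sy p].
    by rewrite /lact big1// => q _; rewrite mxE scaler0.
  transitivity (lact D (x 0 : 'I_n -> A^o) p * (a : A) + lact D (y 0 : 'I_n -> A^o) p).
    rewrite /lact mulr_suml -big_split; apply: eq_bigr => q _.
    by rewrite !mxE [LHS]mulrDr mulrA.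
  by rewrite Sx Sy mul0r addr0.
have [r [g [Sg gS]]] := finite_length_fg_sub fAc (fg_rV _ n) sS.
exists r, (\matrix_(q, s) (g s 0 q : A)); split.
  apply/matrixP => p s; rewrite !mxE -[RHS](Sg s p).
  by apply: eq_bigr => q _; rewrite mxE.
move=> v Dv; have [|c cE] := gS (\row_q (v q : A^c)).
  move=> p; rewrite -[RHS](congr1 (fun f => f p) Dv).
  by apply: eq_bigr => q _; rewrite mxE.
exists c; apply/funext => q.
have := congr1 (fun x : 'rV[A^c]_n => x 0 q) cE; rewrite mxE summxE => ->.
by apply: eq_bigr => s _; rewrite !mxE.
Qed.

(** D0 lists generators of the right ideal where G is defined, D1 gives relations among them, and y
    the values of G on them. Relations force y D1 = 0, and exactness turns G into a |->
    [a *: z 0]. *)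
Lemma baer_of_matrices (N : lmodType A^c) (G : A^c^o * N -> Prop) m r
    (D0 : 'M[A]_(1, m)) (D1 : 'M[A]_(m, r)) :
  submod G -> functional G -> D0 *m D1 = 0 ->
  (forall a c, G (a, c) -> exists w : 'I_m -> A^o, a = lact D0 w 0) ->
  (forall q, exists c, G (D0 0 q, c)) ->
  (forall y : 'I_m -> N, ract y D1 = (fun=> 0) -> exists z, y = ract z D0) ->
  exists c : N, forall (a : A^c) x, G (a, x) -> x = a *: c.
Proof.
move=> sG fG D01 GD DG exN.
pose y q := sval (cid (DG q)).
have yG q : G (D0 0 q, y q) by rewrite /y; case: cid.
have Gpair (w : 'I_m -> A) : G (lact D0 (w : 'I_m -> A^o) 0 : A, pairing y w).
  suff -> : (lact D0 (w : 'I_m -> A^o) 0 : A^c^o, pairing y w) =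
      \sum_q (w q : A^c) *: ((D0 0 q : A^c^o), y q).
    by apply: (submod_sum sG) => q _; exact: (submodZ sG).
  by rewrite [RHS]surjective_pairing; congr pair;
    [rewrite (linear_sum fst)|rewrite (linear_sum snd)].
have [z yz] : exists z, y = ract z D0.
  apply: exN; apply/funext => s; apply: fG.
  have := Gpair (fun q => D1 q s); congr G; congr pair.
  by have := congr1 (fun M : 'M[A]_(1, r) => M 0 s) D01; rewrite !mxE => <-.
exists (z 0) => a x Gax; have [w aw] := GD _ _ Gax.
rewrite (functional_eq sG fG Gax (w' := pairing y w)); last by rewrite aw; exact: Gpair.
rewrite aw yz -pairing_lact /pairing big_ord1.
by [].
Qed.

Lemma baer_of_complexes (N : lmodType A^c) :
  (forall (n : nat -> nat) (D : forall i, 'M[A]_(n i, n i.+1)),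
    (forall i, col_exact (D i) (D i.+1)) -> row_exact_on D N 0) -> baer N.
Proof.
move=> exN G sG fG.
pose L (a : A^c^o) := exists c, G (a, c).
have sL : submod L.
  split; first by exists 0; exact: sG.1.
  by move=> a x y [c Gc] [d Gd]; exists (a *: c + d); exact: (sG.2 a _ _ Gc Gd).
have [m [g [Lg gL]]] := finite_length_fg_sub fAc (fg_self _) sL.
pose D0 : 'M[A]_(1, m) := \row_q (g q : A).
pose kdim p q (E : 'M[A]_(p, q)) := sval (cid (col_kernel_exists E)).
pose kmx p q (E : 'M[A]_(p, q)) : 'M[A]_(q, kdim p q E) :=
  sval (cid (svalP (cid (col_kernel_exists E)))).
have kmxP p q (E : 'M[A]_(p, q)) : col_exact E (kmx p q E).
  exact: (svalP (cid (svalP (cid (col_kernel_exists E))))).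
(* Each matrix carries its dimensions, so that the iteration stays in one type; it resolves the
   quotient of A by the right ideal, whence n 0 = 1. *)
pose next (s : {p & {q & 'M[A]_(p, q)}}) : {p & {q & 'M[A]_(p, q)}} :=
  existT _ (tag (tagged s)) (existT _ (kdim _ _ (tagged (tagged s))) (kmx _ _ (tagged (tagged s)))).
pose s i := iter i next (existT _ 1%N (existT _ m D0)).
pose n i := tag (s i).
pose D i : 'M[A]_(n i, n i.+1) := tagged (tagged (s i)).
have Dex i : col_exact (D i) (D i.+1) by exact: kmxP.
apply: (baer_of_matrices (D0 := D0) (D1 := kmx _ _ D0)) => //.
- exact: (Dex 0%N).1.
- move=> a c Gac; have [|w ->] := gL a; first by exists c.
  by exists w; apply: eq_bigr => q _; rewrite mxE.
- by move=> q; rewrite mxE; exact: Lg.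
exact: (exN n D Dex).
Qed.

End RightIdeals.

Theorem proposition3p2 (A : pzRingType) :
  artin_algebra A -> satisfies_AC A -> finite_inj_dim (A^o : lmodType A) ->
  finite_inj_dim (A^c^o : lmodType A^c) /\
  (finite_findim A /\ finite_findim A^c).
Proof.
move=> aA AC [d /inj_dim_le_idle dA].
have fA := artin_algebra_finite_length aA.
have aAc := artin_algebra_op aA; have fAc := artin_algebra_finite_length aAc.
have [I [fI bI cogen]] := artin_algebra_cogenerator aA.
have [b pb] := AC_csyz_projective fA dA AC fI (baer_injective bI).
pose C := cosyz (artin_algebra_essential_baer aAc) (A^c^o : lmodType A^c).
have fC := fg_self A^c.
(* For the module resolved by D this is Ext^(i+1)(-, C s) = Ext^(i+s+1)(-, A) = 0; the case s = b, i
   = 0 is Baer's criterion for C b. *)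
have exC (n : nat -> nat) (D : forall i, 'M[A]_(n i, n i.+1)) :
    (forall i, col_exact (D i) (D i.+1)) ->
    forall s i, (b <= i + s)%N -> row_exact_on D (C s) i.
  move=> Dex; elim=> [|s IH] i bi.
    rewrite addn0 in bi.
    exact: row_exact_on_self cogen (exact_on_csyz Dex fA fI pb bi).
  have se := cosyz_short_exact (artin_algebra_essential_baer aAc) s fC.
  apply: (row_exact_on_shift Dex se); first by apply: IH; rewrite addSnnS.
  apply: row_exact_on_baer => //.
  have fCs := cosyz_fg (artin_algebra_essential_baer aAc) s fC.
  by have [] := (hull_mapP (artin_algebra_essential_baer aAc) (C s)).1 fCs.
have bC : baer (C b) by apply: (baer_of_complexes fAc) => n D Dex; exact: exC.
have idAc : inj_dim_le (A^c^o : lmodType A^c) b by exact: cosyz_inj_dim_le bC.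
split; first by exists b.
split; first exact: finite_findim_of_idle dA.
exact: finite_findim_of_idle (inj_dim_le_idle idAc).
Qed.
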